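(* Let $E$ be a finite dimensional real vector space, let $n\geq 2$ be an integer, let $0<k<n$, and suppose that $a>0$, $q\in[1,\frac{n}{n-k})$ and $b\in\mathbb{R}$ satisfy $\frac{n+b}{q}=n-k+a$. If $a\notin\mathbb{N}$, then there exists a constant $C>0$, independent of $f$, such that $$\left(\int_{\mathbb{R}^n}|x|^b\,|\mathcal{I}_k f(x)|^q\,dx\right)^{\frac1q}\leq C\int_{\mathbb{R}^n}|x|^a|f(x)|\,dx$$ holds for all $f\in C_c^\infty(\mathbb{R}^n,E)$ satisfying the vanishing moment assumption: $\int_{\mathbb{R}^n}x^\gamma f(x)\,dx=0$ for all multi-indices $\gamma$ with $|\gamma|\leq\lfloor a\rfloor$.
   Context: For $0<k<n$ the Riesz potential is $\mathcal{I}_k f(x):=\int_{\mathbb{R}^n}\frac{f(y)}{|x-y|^{n-k}}\,dy$ (normalised up to a constant depending only on $n,k$). The finite dimensional vector space $E$ is identified with a standard Euclidean space (whose norm is denoted $|\cdot|$), and $\mathcal{I}_k$ acts on $E$-valued functions by integrating componentwise. $\lfloor a\rfloor$ denotes the floor of $a$. The constant $C$ may depend on the parameters $n,k,a,b,q,E$. *)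

(* Defs.v *)
From HB Require Import structures.
From mathcomp Require Import all_boot all_order all_algebra.
From mathcomp Require Import all_classical all_reals all_analysis.
Import Order.TTheory GRing.Theory Num.Theory.
Import numFieldNormedType.Exports.

Set Implicit Arguments.
Unset Strict Implicit.
Unset Printing Implicit Defensive.

Local Open Scope classical_set_scope.
Local Open Scope ring_scope.

(* The sigma-algebra on 'rV[R]_n is generated by the coordinate functions, as  *)
(* the library does for n.-tuple T; it is the Borel sigma-algebra.             *)
Section measurable_rV.
Context {R : realType}.
Variable n : nat.

Definition rV_coor (i : 'I_n) (x : 'rV[R]_n) : R := x ord0 i.

Let rV_set0 : g_sigma_preimage rV_coor set0.
Proof. exact: sigma_algebra0. Qed.

Let rV_setC A : g_sigma_preimage rV_coor A -> g_sigma_preimage rV_coor (~` A).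
Proof. exact: sigma_algebraC. Qed.

Let rV_bigcup (F : _^nat) : (forall i, g_sigma_preimage rV_coor (F i)) ->
  g_sigma_preimage rV_coor (\bigcup_i (F i)).
Proof. exact: sigma_algebra_bigcup. Qed.

HB.instance Definition _ := @isMeasurable.Build default_measure_display
  'rV[R]_n (g_sigma_preimage rV_coor) rV_set0 rV_setC rV_bigcup.

Lemma measurable_rV_coor (i : 'I_n) : measurable_fun [set: 'rV[R]_n] (rV_coor i).
Proof.
move=> _ Y mY; rewrite setTI; apply: sub_sigma_algebra => /=.
rewrite -bigcup_seq/=; exists i => /=; first by rewrite mem_index_enum.
by exists Y => //; rewrite setTI.
Qed.

Lemma measurable_fun_rV d (T : measurableType d) (f : T -> 'rV[R]_n) :
  (forall i, measurable_fun [set: T] (rV_coor i \o f)) ->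
  measurable_fun [set: T] f.
Proof.
move=> mf _ A mA; rewrite setTI.
suff : g_sigma_preimage (fun i => rV_coor i \o f) `<=` measurable.
  by apply; rewrite g_sigma_preimage_comp; exists A => //; rewrite setTI.
apply: smallest_sub; first exact: sigma_algebra_measurable.
rewrite -bigcup_seq; apply: bigcup_sub => i _ B [C mC <-].
exact: mf.
Qed.

End measurable_rV.

Section lebesgue_rV.
Context {R : realType}.

Definition rV_cons n (tv : measurableTypeR R * 'rV[R]_n) : 'rV[R]_n.+1 :=
  \row_i oapp (tv.2 ord0) tv.1 (unlift ord0 i).

Lemma rV_cons0 n tv : rV_coor ord0 (@rV_cons n tv) = tv.1.
Proof. by rewrite /rV_coor mxE unlift_none. Qed.

Lemma rV_consS n tv i : rV_coor (lift ord0 i) (@rV_cons n tv) = tv.2 ord0 i.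
Proof. by rewrite /rV_coor mxE liftK. Qed.

Lemma measurable_rV_cons n :
  measurable_fun [set: measurableTypeR R * 'rV[R]_n] (@rV_cons n).
Proof.
apply: measurable_fun_rV => i.
case: (unliftP ord0 i) => [j ->|->].
- rewrite (_ : _ \o _ = rV_coor j \o snd); last first.
    by apply/funext => tv /=; rewrite rV_consS.
  by apply: measurableT_comp; [exact: measurable_rV_coor|exact: measurable_snd].
- rewrite (_ : _ \o _ = fst); last by apply/funext => tv /=; rewrite rV_cons0.
  exact: measurable_fst.
Qed.

Definition rV_uncons n (x : 'rV[R]_n.+1) : measurableTypeR R * 'rV[R]_n :=
  (rV_coor ord0 x, \row_i rV_coor (lift ord0 i) x).

Lemma rV_consK n : cancel (@rV_cons n) (@rV_uncons n).
Proof.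
move=> tv; rewrite /rV_uncons rV_cons0; case: tv => t v; congr pair => /=.
by apply/rowP => i; rewrite mxE rV_consS.
Qed.

Lemma measurable_rV_uncons n : measurable_fun setT (@rV_uncons n).
Proof.
apply/measurable_fun_pairP; split; first exact: measurable_rV_coor.
apply: measurable_fun_rV => i.
rewrite (_ : _ \o _ = rV_coor (lift ord0 i)); first exact: measurable_rV_coor.
by apply/funext => x /=; rewrite {1}/rV_coor mxE.
Qed.

Section succ.
Variables (n : nat) (mu : {sigma_finite_measure set 'rV[R]_n -> \bar R}).

Definition lebesgue_rV_succ : set 'rV[R]_n.+1 -> \bar R :=
  pushforward (lebesgue_measure \x mu)%E (@rV_cons n).

Let lebesgue_rV_succ0 : lebesgue_rV_succ set0 = 0%E.
Proof. by rewrite /lebesgue_rV_succ /pushforward preimage_set0 measure0. Qed.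

Let lebesgue_rV_succ_ge0 A : (0 <= lebesgue_rV_succ A)%E.
Proof. by rewrite /lebesgue_rV_succ /pushforward measure_ge0. Qed.

Let lebesgue_rV_succ_sigma_additive : semi_sigma_additive lebesgue_rV_succ.
Proof.
have mc := @measurable_rV_cons n.
exact: (@measure_semi_sigma_additive _ _ _
  (measure_function_pushforward__canonical__measure_function_Measure _ mc)).
Qed.

HB.instance Definition _ := isMeasure.Build _ _ _ lebesgue_rV_succ
  lebesgue_rV_succ0 lebesgue_rV_succ_ge0 lebesgue_rV_succ_sigma_additive.

Lemma lebesgue_rV_succX (A : set (measurableTypeR R)) (B : set 'rV[R]_n) :
  measurable A -> measurable B ->
  lebesgue_rV_succ (@rV_uncons n @^-1` (A `*` B)) =
  (lebesgue_measure A * mu B)%E.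
Proof.
move=> mA mB; rewrite -product_measure1E// /lebesgue_rV_succ /pushforward.
by rewrite -comp_preimage (_ : _ \o _ = id) //; apply/funext => tv /=;
  rewrite rV_consK.
Qed.

Let lebesgue_rV_succ_sigma_finite : sigma_finite setT lebesgue_rV_succ.
Proof.
have /sigma_finiteP[F [TF ndF Foo]] := sigma_finiteT (@lebesgue_measure R).
have /sigma_finiteP[G [TG ndG Goo]] := sigma_finiteT mu.
exists (fun k => @rV_uncons n @^-1` (F k `*` G k)).
  rewrite -preimage_bigcup (_ : \bigcup_k _ = setT) ?preimage_setT//.
  apply/seteqP; split => // -[t v] _.
  have [i _ Fit] : (\bigcup_i F i) t by rewrite -TF.
  have [j _ Gjv] : (\bigcup_j G j) v by rewrite -TG.
  exists (maxn i j) => //; split.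
  - by move: t Fit; exact/subsetPset/ndF/leq_maxl.
  - by move: v Gjv; exact/subsetPset/ndG/leq_maxr.
move=> k; have [mF Fk] := Foo k; have [mG Gk] := Goo k; split.
  rewrite -[X in measurable X]setTI; apply: measurable_rV_uncons => //.
  exact: measurableX.
by rewrite lebesgue_rV_succX// lte_mul_pinfty// ge0_fin_numE.
Qed.

HB.instance Definition _ := Measure_isSigmaFinite.Build _ _ _ lebesgue_rV_succ
  lebesgue_rV_succ_sigma_finite.

End succ.

Fixpoint lebesgue_rV n : {sigma_finite_measure set 'rV[R]_n -> \bar R} :=
  if n is n'.+1 then lebesgue_rV_succ (lebesgue_rV n') else \d_(0 : 'rV[R]_0).

Lemma lebesgue_rV_box n (A : 'I_n -> set (measurableTypeR R)) :
  (forall i, measurable (A i)) ->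
  lebesgue_rV n [set x | forall i, A i (x ord0 i)] =
  (\prod_(i < n) lebesgue_measure (A i))%E.
Proof.
elim: n A => [|n IHn] A mA.
  rewrite big_ord0 /= diracE (_ : _ \in _ = true)//.
  by apply/mem_set => -[].
rewrite big_ord_recl -IHn// -lebesgue_rV_succX//; last first.
  set B := (X in measurable X).
  have -> : B = (\big[setI/setT]_(i < n) (rV_coor i @^-1` A (lift ord0 i)))%classic.
    rewrite -bigcap_seq; apply/seteqP; split => x Ax i.
      by move=> _; exact: Ax.
    by apply: (Ax i); exact: mem_index_enum.
  apply: bigsetI_measurable => i _.
  by rewrite -[X in measurable X]setTI; apply: measurable_rV_coor => //; exact: mA.
congr (lebesgue_rV_succ (lebesgue_rV n) _).
apply/seteqP; split => x /=.
  by move=> Ax; split => [|i]; rewrite ?mxE; exact: Ax.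
move=> [A0 AS] i; case: (unliftP ord0 i) => [j ->|-> //].
by have := AS j; rewrite mxE.
Qed.

End lebesgue_rV.

(* The norm `|x| of the library on 'rV[R]_n is the sup norm.                   *)
Definition enorm {R : realType} {n} (x : 'rV[R]_n) : R :=
  Num.sqrt (\sum_(i < n) x ord0 i ^+ 2).

(* C^infinity: the iterated partial derivatives of all orders exist and are    *)
(* continuous. The existence part is needed since 'D_v is a total operator.    *)
Section smooth.
Context {R : realType} {n : nat}.

Definition iter_partial (s : seq 'I_n) (g : 'rV[R]_n -> R) : 'rV[R]_n -> R :=
  foldr (fun i h => 'D_(delta_mx ord0 i) h) g s.

Definition smooth (g : 'rV[R]_n -> R) :=
  forall s : seq 'I_n, continuous (iter_partial s g) /\
    forall (i : 'I_n) (x : 'rV[R]_n),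
      derivable (iter_partial s g) x (delta_mx ord0 i).

End smooth.

(* E is identified with the Euclidean space R^m through the coordinates in a   *)
(* basis e; for integrable g, vintegral g does not depend on the basis.        *)
Section valued.
Context {R : realType} {E : vectType R} {m : nat} (e : m.-tuple E) {n : nat}.

Definition vnorm (v : E) : R := enorm (\row_(j < m) coord e j v).

Definition vintegral (g : 'rV[R]_n -> E) : E :=
  \sum_(j < m) (\int[lebesgue_rV n]_x coord e j (g x)) *: e`_j.

Definition Cc_infty (f : 'rV[R]_n -> E) :=
  (forall j, smooth (fun x => coord e j (f x))) /\
  compact (closure [set x | f x != 0]).

(* For k < n the kernel takes the value 0 on the diagonal (0 `^ p = 0 when     *)
(* p != 0 and 0^-1 = 0), which does not affect the integral.                   *)
Definition riesz_potential (k : R) (f : 'rV[R]_n -> E) (x : 'rV[R]_n) : E :=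
  vintegral (fun y => (enorm (x - y) `^ (n%:R - k))^-1 *: f y).

Definition vanishing_moments (N : int) (f : 'rV[R]_n -> E) :=
  forall gamma : 'I_n -> nat, ((\sum_(i < n) gamma i)%N%:Z <= N) ->
    vintegral (fun x => (\prod_(i < n) x ord0 i ^+ gamma i) *: f x) = 0.

End valued.

(* Main.v *)
Require Import Defs.
From mathcomp Require Import all_boot all_order all_algebra.
From mathcomp Require Import all_classical all_reals all_analysis.
From mathcomp Require Import ring lra measurable_realfun.
Import Order.TTheory GRing.Theory Num.Theory.
Import numFieldNormedType.Exports.

(** Write s = n - k, so that the kernel is |x - y| ^ (-s), and let N be the floor
    of a. As the moments of f of order at most N vanish, any polynomial of degree
    at most N in y may be subtracted from the kernel without changing the
    potential ([Rintegral_reduced_kernel]). The right one is the Taylor polynomial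
    at y = 0 ([taylor_kernel]), and what is left, the reduced kernel R(x, y), is
    smaller far away: it is of size |x|^(-s) (|y|/|x|)^(N+1) for |x| >= 4 |y|, of
    size |x|^(-s) (|y|/|x|)^N for |x| <= |y|/2, and in the intermediate region of
    the size of the kernel itself plus the latter ([exists_kernel_bounds]).

    The heart of the matter is then the estimate
      int |x|^b |R(x, y)|^q dx <= K |y|^(a q)
    of [reduced_kernel_integral]. All three regions contribute the power
    |y|^(a q), by the homogeneity n + b = q (s + a); convergence at infinity is
    a < N + 1, convergence at the origin is N < a (this is where a must not be an
    integer), and convergence at x = y is s q < n. The integrals of powers of the
    norm are bounded by a dyadic decomposition, for which a bound of the measure
    of balls is enough ([integral_powR_near], [integral_powR_far]).

    Finally, Hoelder's inequality for the measure |y|^a |f(y)| dy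
    ([weighted_hoelder]) gives, with M its mass,
      |I f(x)|^q <= C M^(q-1) int |R(x, y)|^q |y|^(-a q) |y|^a |f(y)| dy,
    and integrating against |x|^b with Tonelli's theorem and the estimate above
    bounds the q-th power of the left-hand side by C K M^q.

    The expansion of |x - y|^(-s) is obtained from the one-variable expansion of
    (1 + u)^(-s/2) at u = (|y|^2 - 2 <x,y>) / |x|^2 ([powR1D_taylor]): powers of u
    are polynomials in y that mix degrees, and the terms of degree above N are of
    the order of the error ([trunc_expansion_close]). *)

Local Open Scope classical_set_scope.
Local Open Scope ring_scope.

(** * The Euclidean norm and Borel measurability on row vectors *)

Definition dot {R : realType} {n} (x y : 'rV[R]_n) : R :=
  \sum_(i < n) x ord0 i * y ord0 i.

Lemma dotxx_ge0 (R : realType) n (x : 'rV[R]_n) : 0 <= dot x x.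
Proof. by apply: sumr_ge0 => i _; rewrite -expr2 sqr_ge0. Qed.

Lemma enormE (R : realType) n (x : 'rV[R]_n) : enorm x = Num.sqrt (dot x x).
Proof. by rewrite /enorm /dot; under eq_bigr do rewrite expr2. Qed.

Lemma enorm_ge0 (R : realType) n (x : 'rV[R]_n) : 0 <= enorm x.
Proof. exact: sqrtr_ge0. Qed.

Lemma enorm_sqr (R : realType) n (x : 'rV[R]_n) : enorm x ^+ 2 = dot x x.
Proof. by rewrite enormE sqr_sqrtr// dotxx_ge0. Qed.

Lemma normr_coor_le (R : realType) n (x : 'rV[R]_n) i :
  `|x ord0 i| <= enorm x.
Proof.
rewrite -[leRHS]ger0_norm ?enorm_ge0// -ler_sqr ?nnegrE// !real_normK ?num_real//.
rewrite enorm_sqr /dot (bigD1 i)//= -expr2 lerDl.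
by apply: sumr_ge0 => j _; rewrite -expr2 sqr_ge0.
Qed.

Lemma enorm_le_sum (R : realType) n (x : 'rV[R]_n) :
  enorm x <= \sum_(i < n) `|x ord0 i|.
Proof.
rewrite -ler_sqr ?nnegrE ?enorm_ge0 ?sumr_ge0// enorm_sqr /dot.
rewrite expr2 mulr_suml; apply: ler_sum => i _.
rewrite -expr2 -real_normK ?num_real// expr2 ler_wpM2l//.
by rewrite (bigD1 i)//= lerDl sumr_ge0.
Qed.

Lemma enorm_eq0 (R : realType) n (x : 'rV[R]_n) : (enorm x == 0) = (x == 0).
Proof.
apply/eqP/eqP => [x0|->]; last first.
  by rewrite enormE /dot big1 ?sqrtr0// => i _; rewrite mxE mul0r.
apply/rowP => i; rewrite mxE; apply/eqP; rewrite -normr_le0 -x0.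
exact: normr_coor_le.
Qed.

Lemma dot_combination (R : realType) n (a b : R) (x y : 'rV[R]_n) :
  dot (a *: x + b *: y) (a *: x + b *: y) =
  a ^+ 2 * dot x x + 2 * a * b * dot x y + b ^+ 2 * dot y y.
Proof.
rewrite /dot !mulr_sumr -!big_split/=; apply: eq_bigr => i _.
by rewrite !mxE; ring.
Qed.

Lemma enormB_sqr (R : realType) n (x y : 'rV[R]_n) :
  enorm (x - y) ^+ 2 = dot x x - 2 * dot x y + dot y y.
Proof.
have := dot_combination R n 1 (-1) x y.
by rewrite scale1r scaleN1r enorm_sqr => ->; ring.
Qed.

Lemma normr_dot_le (R : realType) n (x y : 'rV[R]_n) :
  `|dot x y| <= enorm x * enorm y.
Proof.
have [->|y0] := eqVneq y 0.
  rewrite /dot big1 ?normr0 ?mulr_ge0 ?enorm_ge0// => i _.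
  by rewrite mxE mulr0.
rewrite -ler_sqr ?nnegrE ?mulr_ge0 ?enorm_ge0//.
rewrite real_normK ?num_real// exprMn !enorm_sqr.
have yy : 0 < dot y y by rewrite -enorm_sqr exprn_gt0// lt0r enorm_eq0 y0 enorm_ge0.
have := dotxx_ge0 R n (dot y y *: x + (- dot x y) *: y).
rewrite dot_combination => h.
rewrite -(ler_pM2l yy) -subr_ge0; apply: le_trans h _.
by rewrite le_eqVlt; apply/orP; left; apply/eqP; ring.
Qed.

Lemma ler_enormB (R : realType) n (x y : 'rV[R]_n) :
  enorm (x - y) <= enorm x + enorm y.
Proof.
rewrite -ler_sqr ?nnegrE ?addr_ge0 ?enorm_ge0// enormB_sqr sqrrD !enorm_sqr.
rewrite lerD2r lerD2l -[leRHS]mulr_natr [leRHS]mulrC -mulrN ler_wpM2l//.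
by apply: le_trans (normr_dot_le _ _ _ _); rewrite -normrN ler_norm.
Qed.

Lemma enormN (R : realType) n (x : 'rV[R]_n) : enorm (- x) = enorm x.
Proof. by rewrite /enorm; under eq_bigr do rewrite mxE sqrrN. Qed.

Lemma enormBC (R : realType) n (x y : 'rV[R]_n) : enorm (x - y) = enorm (y - x).
Proof. by rewrite -enormN opprB. Qed.

Section measurability.
Context {d} {T : measurableType d} {R : realType} {n : nat}.
Implicit Types f g : T -> 'rV[R]_n.

Lemma measurable_fun_coor f i : measurable_fun setT f ->
  measurable_fun setT (fun t => f t ord0 i).
Proof. by move=> mf; apply: (measurableT_comp (measurable_rV_coor i)). Qed.

Lemma measurable_fun_dot f g : measurable_fun setT f -> measurable_fun setT g ->
  measurable_fun setT (fun t => dot (f t) (g t)).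
Proof.
move=> mf mg; apply: measurable_sum => i.
by apply: measurable_funM; exact: measurable_fun_coor.
Qed.

Lemma measurable_fun_enorm f : measurable_fun setT f ->
  measurable_fun setT (fun t => enorm (f t)).
Proof.
move=> mf; under eq_fun do rewrite enormE.
have ms := continuous_measurable_fun (@sqrt_continuous R).
apply: (measurableT_comp ms).
exact: measurable_fun_dot.
Qed.

Lemma measurable_fun_subrV f g : measurable_fun setT f -> measurable_fun setT g ->
  measurable_fun setT (fun t => f t - g t).
Proof.
move=> mf mg; apply: measurable_fun_rV => i.
rewrite (_ : _ \o _ = (fun t => f t ord0 i - g t ord0 i)); last first.
  by apply/funext => t; rewrite /= /rV_coor !mxE.
by apply: measurable_funB; exact: measurable_fun_coor.
Qed.

Lemma measurable_set_le (h : T -> R) r : measurable_fun setT h ->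
  measurable [set t | h t <= r].
Proof.
move=> mh; rewrite -[X in measurable X]setTI.
have := mh measurableT `]-oo, r]%classic (measurable_itv _).
by congr (measurable (_ `&` _)); apply/seteqP; split => t /=; rewrite in_itv.
Qed.

Lemma measurable_set_ge (h : T -> R) r : measurable_fun setT h ->
  measurable [set t | r <= h t].
Proof.
move=> mh; rewrite -[X in measurable X]setTI.
have := mh measurableT `[r, +oo[%classic (measurable_itv _).
by congr (measurable (_ `&` _)); apply/seteqP; split => t /=; rewrite in_itv/= andbT.
Qed.

End measurability.

(** The sigma-algebra is generated by the coordinates, so boxes are measurable, and
an open set is the union of the countably many boxes with rational centre and
side 1/(k+1) that it contains. *)
Lemma open_measurable_rV (R : realType) n (U : set 'rV[R]_n) :
  open U -> measurable U.
Proof.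
move=> oU.
pose box (p : 'rV[rat]_n * nat) : set 'rV[R]_n :=
  [set x | forall i, `|x ord0 i - ratr (p.1 ord0 i)| < p.2.+1%:R^-1].
pose F p : set 'rV[R]_n := if pselect (box p `<=` U) then box p else set0.
have -> : U = \bigcup_p F p.
  apply/seteqP; split => [x Ux|x [p _]]; last first.
    by rewrite /F; case: pselect => //= pU; exact: pU.
  move: oU; rewrite openE => /(_ _ Ux); rewrite /interior.
  move=> /nbhs_ballP[e /= e0 xeU].
(* The box has half-width 1/(k+1) and x is within 1/(k+1) of its centre. *)
  have [k ke] : exists k, 2 / k.+1%:R < e.
    exists (Num.truncn (2 / e)).
    by rewrite ltr_pdivrMr// mulrC -ltr_pdivrMr// truncnS_gt.
  have k0 : 0 < k.+1%:R^-1 :> R by rewrite invr_gt0.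
  have /choice[q qx] : forall i, exists q : rat,
      ratr q \in `](x ord0 i - k.+1%:R^-1), (x ord0 i + k.+1%:R^-1)[.
    by move=> i; apply: rat_in_itvoo; rewrite ltrBlDr -addrA ltrDl addr_gt0.
  have bU : box (\row_i q i, k) `<=` U.
    move=> y yb; apply: xeU; split => // i j; rewrite (ord1 i).
    have := yb j; have := qx j; rewrite /ball /= mxE in_itv/= => /andP[q1 q2].
    rewrite ltr_norml => /andP[y1 y2].
    move: ke q1 q2 y1 y2; set dl := k.+1%:R^-1 => ke q1 q2 y1 y2.
    by rewrite ltr_norml; apply/andP; split; lra.
  exists (\row_i q i, k) => //; rewrite /F; case: pselect => // _ i /=.
  rewrite mxE; have := qx i; rewrite in_itv/=; set dl := k.+1%:R^-1 => /andP[q1 q2].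
  by rewrite ltr_norml; apply/andP; split; lra.
apply: countable_bigcupT_measurable => [|p]; first exact: countableP.
rewrite /F; case: pselect => //= _.
have -> : box p = \big[setI/setT]_(i < n)
    (rV_coor i @^-1` ball (ratr (p.1 ord0 i) : R) p.2.+1%:R^-1).
  rewrite -bigcap_seq; apply/seteqP; split => x xb i.
    by move=> _; rewrite /= /ball/= distrC; exact: xb.
  by rewrite distrC; apply: (xb i); exact: mem_index_enum.
apply: bigsetI_measurable => i _.
rewrite -[X in measurable X]setTI; apply: measurable_rV_coor => //.
exact: measurable_ball.
Qed.

Lemma continuous_measurable_rV (R : realType) n (g : 'rV[R]_n -> R) :
  continuous g -> measurable_fun setT g.
Proof.
move=> /continuousP cg; apply: (measurability _ (RGenOpens.measurableE R)).
move=> _ [_ [a [b ->] <-]]; rewrite setTI; apply: open_measurable_rV.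
by apply: cg; exact: interval_open.
Qed.

(** * Taylor expansion of a real power, truncated by degree *)

(** The power is monotone, increasing or decreasing with the sign of the exponent;
the sum of the end values bounds it in both cases. *)
Lemma powR_le_ends (R : realType) (t l h x : R) :
  0 < l -> l <= x <= h -> x `^ t <= l `^ t + h `^ t.
Proof.
move=> l0 /andP[lx xh]; have x0 := lt_le_trans l0 lx.
have h0 := lt_le_trans x0 xh.
have [t0|t0] := leP 0 t.
  rewrite (@le_trans _ _ (h `^ t))//; last by rewrite lerDr powR_ge0.
  by apply: ge0_ler_powR => //; rewrite nnegrE ltW.
rewrite (@le_trans _ _ (l `^ t))//; last by rewrite lerDl powR_ge0.
rewrite -[t]opprK (powRN x) (powRN l) lef_pV2 ?posrE ?powR_gt0//.
by apply: ge0_ler_powR => //; rewrite ?nnegrE ?oppr_ge0 ltW.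
Qed.

(** By induction on the order: the derivative of the remainder of order M.+1 for
the exponent t is t times the remainder of order M for the exponent t - 1, so
the mean value theorem gains one power of u. The radius 9/16 < 1 is what the
region |y| <= |x| / 4 requires, see exists_kernel_bounds. *)
Lemma powR1D_taylor (R : realType) (M : nat) (t : R) :
  exists p : {poly R}, (size p <= M)%N /\ exists C : R, 0 <= C /\
    forall u, `|u| <= 9 / 16 -> `|(1 + u) `^ t - p.[u]| <= C * `|u| ^+ M.
Proof.
elim: M t => [|M IH] t.
  exists 0; split; first by rewrite size_poly0.
  exists (4^-1 `^ t + 2 `^ t); split; first by rewrite addr_ge0 ?powR_ge0.
  move=> u; rewrite ler_norml => /andP[u1 u2].
  rewrite horner0 subr0 expr0 mulr1 ger0_norm ?powR_ge0//.
  by apply: powR_le_ends; lra.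
have [p [sp [C [C0 HC]]]] := IH (t - 1).
pose q : {poly R} :=
  \poly_(i < M.+1) (if i is j.+1 then t / j.+1%:R * p`_j else 1).
have qp : q^`() = t *: p.
  apply/polyP => i; rewrite coef_deriv coef_poly coefZ ltnS.
  case: ltnP => [_|Mi]; last by rewrite mul0rn nth_default ?mulr0// (leq_trans sp).
  by rewrite /= -[LHS]mulr_natr mulrAC divfK// pnatr_eq0.
exists q; split; first exact: size_poly.
exists (`|t| * C); split; first by rewrite mulr_ge0.
move=> u u916.
pose g (x : R) := (1 + x) `^ t - q.[x].
pose dg (x : R) := t * ((1 + x) `^ (t - 1) - p.[x]).
have g0 : g 0 = 0.
  rewrite /g addr0 powR1 horner_coef0 coef_poly/= subrr//.
have Dg (x : R) : `|x| <= `|u| -> is_derive x 1 g (dg x).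
  move=> xu; have /ler_normlP[x1 x2] := le_trans xu u916.
  have D1 : is_derive x 1 (fun x : R => (1 + x) `^ t) (t * (1 + x) `^ (t - 1)).
    have x0 : 0 < 1 + x by lra.
    have := @is_derive1_comp _ (fun y : R => y `^ t) (fun x : R => 1 + x) x
      (t * (1 + x) `^ (t - 1)) 1 (is_derive1_powR t x0).
    rewrite mulr1; apply.
    rewrite -[X in is_derive _ _ _ X]add0r.
    exact: is_deriveD.
  have := @is_deriveB _ _ _ _ (horner q) _ _ _ _ D1 (is_derive_poly q x).
  by rewrite qp hornerZ -mulrBr.
have Cg a b : (forall x, x \in `[a, b] -> `|x| <= `|u|) ->
    {within `[a, b], continuous g}.
  move=> H; apply: derivable_within_continuous => x xab.
  by have [] := Dg _ (H _ xab).
have dgle x : `|x| <= `|u| -> `|dg x| <= `|t| * C * `|u| ^+ M.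
  move=> xu; rewrite normrM -mulrA ler_wpM2l//.
  apply: le_trans (HC _ (le_trans xu u916)) _.
  by rewrite ler_wpM2l// lerXn2r ?nnegrE.
suff [c cu E] : exists2 c, `|c| <= `|u| & g u = dg c * u.
  by rewrite -/(g u) E normrM exprSr mulrA ler_wpM2r//; exact: dgle.
have [u0|u0] := leP 0 u.
  have H x : x \in `[0, u] -> `|x| <= `|u|.
    by rewrite in_itv/= => /andP[x0 xu]; rewrite !ger0_norm.
  have [|c cu] := @MVT_segment _ g dg 0 u u0 _ (Cg _ _ H).
    move=> x; rewrite in_itv/= => /andP[/ltW x0 /ltW xu].
    by apply: Dg; apply: H; rewrite in_itv/= x0.
  by rewrite g0 !subr0 => E; exists c => //; apply: H.
have H x : x \in `[u, 0] -> `|x| <= `|u|.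
  by rewrite in_itv/= => /andP[ux x0]; rewrite ler0_norm// ltr0_norm// lerN2.
have [|c cu] := @MVT_segment _ g dg u 0 (ltW u0) _ (Cg _ _ H).
  move=> x; rewrite in_itv/= => /andP[/ltW x0 /ltW xu].
  by apply: Dg; apply: H; rewrite in_itv/= x0.
rewrite g0 !sub0r mulrN => /oppr_inj E; exists c => //; exact: H.
Qed.

(** Write u = - 2 z + v, where z has degree one and v has degree two in the variable
y of the kernel. Expanding p.[u] by the binomial formula, the term
z ^ (j - i) v ^ i has degree i + j; only those of degree at most N are kept,
since moments of order at most N are all that vanish. *)
Definition trunc_expansion (R : realType) (N : nat) (p : {poly R}) (z v : R) : R :=
  \sum_(j < N.+1) \sum_(i < j.+1 | (i + j <= N)%N)
    p`_j * 'C(j, i)%:R * (- 2 * z) ^+ (j - i) * v ^+ i.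

(** The sum of the absolute values of all the coefficients of the expansion,
truncated or not. *)
Definition expansion_bound (R : realType) (N : nat) (p : {poly R}) : R :=
  \sum_(j < N.+1) \sum_(i < j.+1) `|p`_j| * 'C(j, i)%:R * 2 ^+ (j - i).

Lemma expansion_bound_ge0 (R : realType) (N : nat) (p : {poly R}) :
  0 <= expansion_bound R N p.
Proof.
apply: sumr_ge0 => j _; apply: sumr_ge0 => i _.
by rewrite !mulr_ge0 ?exprn_ge0.
Qed.

Lemma expansion_term_le (R : realType) (c z t K : R) (i j k : nat) :
  (i <= j)%N -> 0 <= t -> `|z| <= t -> t ^+ (i + j) <= K ->
  `|c * 'C(j, i)%:R * (- 2 * z) ^+ (j - i) * (t ^+ 2) ^+ i| <=
  `|c| * 'C(j, i)%:R * 2 ^+ (j - i) * K.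
Proof.
move=> ij t0 zt tK.
rewrite exprMn !normrM normr_nat -!mulrA; do 2 rewrite ler_wpM2l//.
rewrite !normrX normrN normr_nat ler_wpM2l// ?exprn_ge0//.
apply: le_trans tK; rewrite -exprM (_ : (i + j)%N = (j - i) + 2 * i)%N; last first.
  by rewrite mul2n -addnn addnA subnK// addnC.
by rewrite exprD (ger0_norm t0) ler_wpM2r ?exprn_ge0// lerXn2r ?nnegrE.
Qed.

(** The terms that the truncation drops have degree i + j > N, and
t ^ (i + j) <= t ^ (N + 1) because t <= 1. *)
Lemma trunc_expansion_close (R : realType) (N : nat) (p : {poly R}) (z t : R) :
  (size p <= N.+1)%N -> `|z| <= t -> t <= 4^-1 ->
  `|p.[- 2 * z + t ^+ 2] - trunc_expansion R N p z (t ^+ 2)| <=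
  expansion_bound R N p * t ^+ N.+1.
Proof.
move=> sp zt t4; have t0 : 0 <= t := le_trans (normr_ge0 _) zt.
rewrite (horner_coef_wide _ sp) /trunc_expansion -sumrB.
rewrite /expansion_bound mulr_suml.
apply: le_trans (ler_norm_sum _ _ _) _; apply: ler_sum => j _.
rewrite exprDn mulr_sumr.
rewrite [X in _ - X]big_mkcond/= -sumrB mulr_suml.
apply: le_trans (ler_norm_sum _ _ _) _; apply: ler_sum => i _.
have -> : p`_j * ((- 2 * z) ^+ (j - i) * (t ^+ 2) ^+ i *+ 'C(j, i)) =
    p`_j * 'C(j, i)%:R * (- 2 * z) ^+ (j - i) * (t ^+ 2) ^+ i.
  by rewrite -mulr_natl !mulrA.
case: leqP => ijN.
  by rewrite subrr normr0 !mulr_ge0 ?exprn_ge0.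
rewrite subr0; apply: expansion_term_le => //; first by rewrite -ltnS.
rewrite -(subnK ijN) exprD ler_piMl ?exprn_ge0//.
by rewrite exprn_ile1//; lra.
Qed.

(** The terms that are kept have degree i + j <= N, and
(4 t) ^ (i + j) <= (4 t) ^ N because 4 t >= 1. *)
Lemma trunc_expansion_le (R : realType) (N : nat) (p : {poly R}) (z t : R) :
  `|z| <= t -> 4^-1 <= t ->
  `|trunc_expansion R N p z (t ^+ 2)| <= expansion_bound R N p * (4 * t) ^+ N.
Proof.
move=> zt t4; have t0 : 0 <= t := le_trans (normr_ge0 _) zt.
rewrite /expansion_bound mulr_suml.
apply: le_trans (ler_norm_sum _ _ _) _; apply: ler_sum => j _.
rewrite big_mkcond/= mulr_suml.
apply: le_trans (ler_norm_sum _ _ _) _; apply: ler_sum => i _.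
case: leqP => ijN; last by rewrite normr0 !mulr_ge0 ?exprn_ge0//; lra.
apply: expansion_term_le => //; first by rewrite -ltnS.
rewrite (@le_trans _ _ ((4 * t) ^+ (i + j)))//.
  by rewrite lerXn2r ?nnegrE//; lra.
by apply: ler_weXn2l => //; lra.
Qed.

(** * Integrals of powers of the Euclidean norm over dyadic shells *)

Definition eball {R : realType} {n} (c : 'rV[R]_n) (r : R) : set 'rV[R]_n :=
  [set x | enorm (x - c) <= r].

Lemma measurable_eball (R : realType) n (c : 'rV[R]_n) r :
  measurable (eball c r).
Proof.
apply: measurable_set_le; apply: measurable_fun_enorm.
by apply: measurable_fun_subrV => //; exact: measurable_cst.
Qed.

Lemma measurable_EFin_cst_indic_eball (R : realType) n (c : 'rV[R]_n) (a r : R) :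
  measurable_fun setT (fun x => (a * (\1_(eball c r) x : R))%:E).
Proof.
apply/measurable_EFinP; apply: measurable_funM; first exact: measurable_cst.
by apply: measurable_indic; exact: measurable_eball.
Qed.

(** A Euclidean ball lies in a cube. *)
Lemma lebesgue_eball_le (R : realType) n (c : 'rV[R]_n) (r : R) : 0 <= r ->
  (lebesgue_rV n (eball c r) <= ((2 * r) ^+ n)%:E)%E.
Proof.
move=> r0.
pose A i : set (measurableTypeR R) := `[(c ord0 i - r), (c ord0 i + r)]%classic.
have mA i : measurable (A i) by exact: measurable_itv.
have -> : (((2 * r) ^+ n)%:E = lebesgue_rV n [set x | forall i, A i (x ord0 i)])%E.
  rewrite lebesgue_rV_box//.
  transitivity (\prod_(i < n) (2 * r)%:E)%E.
    by rewrite prodEFin prodr_const card_ord.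
  apply: eq_bigr => i _; rewrite lebesgue_measure_itv/= lte_fin.
  case: ifPn => [_|]; first by rewrite -EFinD; congr EFin; ring.
  rewrite -leNgt => h; congr EFin; lra.
have mB : measurable [set x : 'rV[R]_n | forall i, A i (x ord0 i)].
  have -> : [set x : 'rV[R]_n | forall i, A i (x ord0 i)] =
      \big[setI/setT]_(i < n) (rV_coor i @^-1` A i).
    rewrite -bigcap_seq; apply/seteqP; split => x Ax i; first by move=> _; exact: Ax.
    by apply: (Ax i); exact: mem_index_enum.
  apply: bigsetI_measurable => i _.
  by rewrite -[X in measurable X]setTI; apply: measurable_rV_coor => //; exact: mA.
apply: le_measure; first by rewrite inE; exact: measurable_eball.
  by rewrite inE; exact: mB.
move=> x; rewrite /eball/= => xc i; rewrite /A/= in_itv/=.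
have := le_trans (normr_coor_le _ _ (x - c) i) xc.
by rewrite !mxE ler_norml => /andP[h1 h2]; apply/andP; split; lra.
Qed.

Lemma nneseries_term_le (R : realType) (u : nat -> \bar R) j :
  (forall i, (0 <= u i)%E) -> (u j <= \sum_(i <oo) u i)%E.
Proof.
move=> u0; apply: le_trans (nneseries_lim_ge j.+1 _) => //.
by rewrite big_nat_recr//= leeDr// sume_ge0.
Qed.

(** The integral of a nonnegative function is a supremum over the simple functions
below it, hence monotone also on functions that are not measurable. *)
Lemma ge0_le_integral_nomeas d (T : measurableType d) (R : realType)
    (mu : {measure set T -> \bar R}) (f g : T -> \bar R) :
  (forall x, (0 <= f x)%E) -> (forall x, (f x <= g x)%E) ->
  (\int[mu]_x f x <= \int[mu]_x g x)%E.
Proof.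
move=> f0 fg; have g0 x : (0 <= g x)%E := le_trans (f0 x) (fg x).
rewrite !ge0_integralTE//; apply: ereal_sup_le => _ [h hf <-].
by exists h => // x; exact: le_trans (hf x) (fg x).
Qed.

Section shells.
Context {R : realType} (n : nat) (t : R).

(** A majorant, up to the factor 1 + 2 `^ t, of enorm (x - c) `^ t: on the shell of
radii kap ^ j rho and 2 kap ^ j rho this power is comparable with
(kap ^ j rho) `^ t. With kap = 1/2 the shells exhaust a punctured ball, with
kap = 2 the complement of a ball. *)
Definition shell_series (kap rho : R) (c x : 'rV[R]_n) : \bar R :=
  (\sum_(j <oo) ((kap ^+ j * rho) `^ t * \1_(eball c (2 * (kap ^+ j * rho))) x)%:E)%E.

Lemma shell_series_ge0 (kap rho : R) (c x : 'rV[R]_n) :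
  (0 <= shell_series kap rho c x)%E.
Proof. by apply: nneseries_ge0 => j _ _; rewrite lee_fin mulr_ge0 ?powR_ge0. Qed.

Lemma measurable_shell_series (kap rho : R) (c : 'rV[R]_n) :
  measurable_fun setT (shell_series kap rho c).
Proof.
apply: ge0_emeasurable_sum => [j x _ _|j _].
  by rewrite lee_fin mulr_ge0 ?powR_ge0.
exact: measurable_EFin_cst_indic_eball.
Qed.

(** The j-th term integrates to at most a constant times (kap ^ j rho) `^ (n + t),
and these form a geometric series. *)
Lemma shell_series_integral (kap : R) :
  0 < kap -> kap `^ (n%:R + t) < 1 -> exists C : R, 0 <= C /\
  forall rho c, 0 < rho ->
  (\int[lebesgue_rV n]_x shell_series kap rho c x <= (C * rho `^ (n%:R + t))%:E)%E.
Proof.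
move=> kap0 kap1; set K := kap `^ (n%:R + t) in kap1 *.
have K0 : 0 <= K by exact: powR_ge0.
exists (4 ^+ n / (1 - K)); split.
  by rewrite divr_ge0 ?exprn_ge0// subr_ge0 ltW.
move=> rho c rho0; rewrite /shell_series integral_nneseries//; last 2 first.
  by move=> j; exact: measurable_EFin_cst_indic_eball.
  by move=> j x _; rewrite lee_fin mulr_ge0 ?powR_ge0.
have step (j : nat) : (\int[lebesgue_rV n]_x
    ((kap ^+ j * rho) `^ t * \1_(eball c (2 * (kap ^+ j * rho))) x)%:E <=
    (4 ^+ n * rho `^ (n%:R + t) * K ^+ j)%:E)%E.
  have kr : 0 < kap ^+ j * rho by rewrite mulr_gt0 ?exprn_gt0.
  have mb := measurable_eball R n c (2 * (kap ^+ j * rho)).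
  under eq_integral do rewrite EFinM.
  rewrite ge0_integralZl_EFin//; last 2 first.
  - exact/measurable_EFinP/measurable_indic.
  - exact: powR_ge0.
  rewrite integral_indic// setIT.
  apply: le_trans (lee_wpmul2l _ (lebesgue_eball_le _ _ _ _ _)) _.
  - by rewrite lee_fin powR_ge0.
  - by rewrite mulr_ge0// ltW.
  rewrite -EFinM lee_fin (_ : 2 * (2 * _) = 4 * (kap ^+ j * rho)); last by ring.
  rewrite [in leLHS]exprMn mulrCA -[leRHS]mulrA ler_wpM2l ?exprn_ge0//.
  rewrite -(powR_mulrn n (ltW kr)) [leLHS]mulrC -powRD; last by rewrite (gt_eqF kr) implybT.
  by rewrite powRM ?exprn_ge0 ?(ltW rho0) ?(ltW kap0)// mulrC
    -(powR_mulrn j (ltW kap0)) powRAC powR_mulrn ?powR_ge0.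
apply: le_trans (lee_nneseries _ (fun j _ => step j)) _ => //.
  by move=> j _ _; apply: integral_ge0 => x _; rewrite lee_fin mulr_ge0 ?powR_ge0.
set a := 4 ^+ n * _.
have cv := @cvg_geometric_series R a K.
rewrite ger0_norm// in cv; have {}cv := cv kap1.
have -> : 4 ^+ n / (1 - K) * rho `^ (n%:R + t) = a / (1 - K) by rewrite /a mulrAC.
have a0 : 0 <= a by rewrite mulr_ge0 ?exprn_ge0 ?powR_ge0.
apply: lime_le.
  by apply: is_cvg_nneseries => j _ _; rewrite lee_fin mulr_ge0 ?exprn_ge0.
apply: nearW => N; rewrite sumEFin lee_fin.
have := nondecreasing_cvgn_le _ (cvgP _ cv) N.
rewrite (cvg_lim _ cv)//; apply.
by apply: nondecreasing_series => j _ _; rewrite mulr_ge0 ?exprn_ge0.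
Qed.

Lemma shell_series_ge (kap rho : R) (c x : 'rV[R]_n) (j : nat) :
  0 < kap -> 0 < rho ->
  kap ^+ j * rho <= enorm (x - c) <= 2 * (kap ^+ j * rho) ->
  ((enorm (x - c) `^ t)%:E <= (1 + 2 `^ t)%:E * shell_series kap rho c x)%E.
Proof.
move=> kap0 rho0 /andP[h1 h2].
have kr : 0 < kap ^+ j * rho by rewrite mulr_gt0 ?exprn_gt0.
apply: le_trans (lee_wpmul2l _ (nneseries_term_le _ _ j _)); last 2 first.
- by rewrite lee_fin addr_ge0 ?powR_ge0.
- by move=> i; rewrite lee_fin mulr_ge0 ?powR_ge0.
rewrite -EFinM lee_fin indicE mem_set// mulr1.
apply: le_trans (powR_le_ends _ t _ (2 * (kap ^+ j * rho)) _ kr _) _; first exact/andP.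
by rewrite [leRHS]mulrDl mul1r -powRM ?(ltW kr).
Qed.

Lemma integral_le_shell_series (kap : R) :
  0 < kap -> kap `^ (n%:R + t) < 1 -> exists C : R, 0 <= C /\
  forall rho c (g : 'rV[R]_n -> \bar R), 0 < rho -> (forall x, (0 <= g x)%E) ->
  (forall x, (g x <= (1 + 2 `^ t)%:E * shell_series kap rho c x)%E) ->
  (\int[lebesgue_rV n]_x g x <= (C * rho `^ (n%:R + t))%:E)%E.
Proof.
move=> kap0 kap1; have [C [C0 HC]] := shell_series_integral _ kap0 kap1.
have t0 : 0 <= 1 + 2 `^ t :> R by rewrite addr_ge0 ?powR_ge0.
exists ((1 + 2 `^ t) * C); split; first by rewrite mulr_ge0.
move=> rho c g rho0 g0 gS; apply: le_trans (ge0_le_integral_nomeas _ _ _ _ _ _ g0 gS) _.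
rewrite ge0_integralZl_EFin//.
- by rewrite -mulrA EFinM lee_wpmul2l// HC.
- by move=> x _; exact: shell_series_ge0.
- exact: measurable_shell_series.
Qed.

Lemma integral_powR_near : 0 < n%:R + t -> exists C : R, 0 <= C /\
  forall rho c, 0 < rho ->
  (\int[lebesgue_rV n]_x (enorm (x - c) `^ t * \1_(eball c rho) x)%:E
   <= (C * rho `^ (n%:R + t))%:E)%E.
Proof.
move=> nt; have k0 : 0 < 2^-1 :> R by rewrite invr_gt0.
have k1 : 2^-1 `^ (n%:R + t) < 1 :> R.
  have E : 1 = 1 `^ (n%:R + t) :> R by rewrite powR1.
  by rewrite [ltRHS]E gt0_ltr_powR// ?nnegrE ?invf_lt1// ?ltr1n// ltW.
have [C [C0 HC]] := integral_le_shell_series _ k0 k1.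
exists C; split => // rho c rho0; apply: (HC _ c) => // x.
  by rewrite lee_fin mulr_ge0 ?powR_ge0.
have S0 := shell_series_ge0 2^-1 rho c x.
rewrite indicE; case: (boolP (x \in _)) => [|_]; last first.
  by rewrite mulr0 mule_ge0// lee_fin addr_ge0 ?powR_ge0.
rewrite mulr1 inE /eball/= => xc.
have [x0|x0] := eqVneq (enorm (x - c)) 0.
  rewrite x0; have [t0|t0] := eqVneq t 0; last first.
    by rewrite powR0// mule_ge0// lee_fin addr_ge0 ?powR_ge0.
  apply: le_trans (lee_wpmul2l _ (nneseries_term_le _ _ 0%N _)); last 2 first.
  - by rewrite lee_fin addr_ge0 ?powR_ge0.
  - by move=> i; rewrite lee_fin mulr_ge0 ?powR_ge0.
  rewrite -EFinM lee_fin indicE mem_set ?t0 ?powRr0; last first.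
    by rewrite /eball/= x0 expr0 !mulr_ge0// ltW.
  by rewrite !mulr1 lerDl.
have {}x0 : 0 < enorm (x - c) by rewrite lt0r x0 enorm_ge0.
have [j0 j0P] : exists j, 2^-1 ^+ j * rho <= enorm (x - c).
  have /cvgrPdist_lt/(_ (enorm (x - c) / rho)) : (fun j => 2^-1 ^+ j : R) @ \oo --> (0 : R).
    by apply: cvg_expr; rewrite ger0_norm ?ltW// invf_lt1 ?ltr1n.
  rewrite divr_gt0// => /(_ isT)[j _ /(_ j (leqnn j))].
  rewrite /= sub0r normrN ger0_norm ?exprn_ge0 ?ltW// ltr_pdivlMr// => /ltW h.
  by exists j.
(* By minimality of j, the point lies in the j-th shell. *)
have ex : exists j, 2^-1 ^+ j * rho <= enorm (x - c) by exists j0.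
have := ex_minnP ex; case: (ex_minnP ex) => j jP jmin _.
apply: (@shell_series_ge _ _ _ _ j) => //; rewrite jP/=.
case: j jP jmin => [|j] jP jmin.
  by rewrite expr0 mul1r mulr_natl mulr2n ler_wpDr// ltW.
have : ~~ (2^-1 ^+ j * rho <= enorm (x - c)).
  by apply/negP => /jmin; rewrite ltnn.
by rewrite -ltNge => /ltW; rewrite exprS !mulrA divff// mul1r.
Qed.

(** The same dyadic argument outside a ball, where the power must decay faster than
enorm x `^ (- n). *)
Lemma integral_powR_far : n%:R + t < 0 -> exists C : R, 0 <= C /\
  forall rho, 0 < rho ->
  (\int[lebesgue_rV n]_x (enorm x `^ t * (\1_[set z | rho <= enorm z] x : R))%:E
   <= (C * rho `^ (n%:R + t))%:E)%E.
Proof.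
move=> nt; have k0 : 0 < 2 :> R by [].
have k1 : 2 `^ (n%:R + t) < 1 :> R.
  rewrite -[n%:R + t]opprK powRN invf_lt1 ?powR_gt0//.
  have E : 1 = 1 `^ (- (n%:R + t)) :> R by rewrite powR1.
  by rewrite [ltLHS]E gt0_ltr_powR// ?nnegrE ?ltr1n// oppr_gt0.
have [C [C0 HC]] := integral_le_shell_series _ k0 k1.
exists C; split => // rho rho0; apply: (HC _ 0) => // x.
  by rewrite lee_fin mulr_ge0 ?powR_ge0.
have S0 := shell_series_ge0 2 rho 0 x.
rewrite indicE; case: (boolP (x \in _)) => [|_]; last first.
  by rewrite mulr0 mule_ge0// lee_fin addr_ge0 ?powR_ge0.
rewrite inE/= => rx; rewrite mulr1 -[in leLHS](subr0 x).
have ex : exists j, enorm x <= 2 * (2 ^+ j * rho).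
  exists (Num.truncn (enorm x / rho)).
  rewrite mulrA -exprS -ler_pdivrMr//; apply: ltW.
  apply: lt_le_trans (truncnS_gt _) _.
  by rewrite -natrX ler_nat ltnW// ltn_expl.
have := ex_minnP ex; case: (ex_minnP ex) => j jP jmin _.
apply: (@shell_series_ge _ _ _ _ j) => //; rewrite subr0 jP andbT.
case: j jP jmin => [|j] jP jmin; first by rewrite expr0 mul1r.
have : ~~ (enorm x <= 2 * (2 ^+ j * rho)).
  by apply/negP => /jmin; rewrite ltnn.
by rewrite -ltNge => /ltW; rewrite exprS mulrA.
Qed.

End shells.

(** * The kernel with its Taylor polynomial removed *)

Lemma measurable_sum_cond d (T : measurableType d) (R : realType) I (r : seq I)
    (P : pred I) (h : I -> T -> R) :
  (forall i, P i -> measurable_fun setT (h i)) ->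
  measurable_fun setT (fun x => \sum_(i <- r | P i) h i x).
Proof.
move=> mh.
have -> : (fun x => \sum_(i <- r | P i) h i x) =
    (fun x => \sum_(i <- r) (if P i then h i x else 0)).
  by apply/funext => x /=; rewrite big_mkcond.
by apply: measurable_sum => i; case: (boolP (P i)) => [/mh//|_]; exact: measurable_cst.
Qed.

Section reduced_kernel.
Context {R : realType} {n : nat} (N : nat) (s : R) (p : {poly R}).
Implicit Types x y : 'rV[R]_n.

(** With z = <x,y> / |x|^2 and v = |y|^2 / |x|^2 one has
|x - y|^2 = |x|^2 (1 - 2 z + v); this is the part of degree at most N in y of
the expansion of |x - y| ^ (-s), when p is the Taylor polynomial of
(1 + u) ^ (- s / 2). *)
Definition taylor_kernel x y : R :=
  (enorm x `^ s)^-1 *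
  trunc_expansion R N p (dot x y / enorm x ^+ 2) (dot y y / enorm x ^+ 2).

Definition reduced_kernel x y : R := (enorm (x - y) `^ s)^-1 - taylor_kernel x y.

(** Thanks to the convention for division by zero, the polynomial subtracted from
the kernel is 0 at x = 0; so no point x has to be excluded below. *)
Lemma taylor_kernel0 y : s != 0 -> taylor_kernel 0 y = 0.
Proof.
move=> s0; rewrite /taylor_kernel.
have -> : enorm (0 : 'rV[R]_n) = 0 by apply/eqP; rewrite enorm_eq0.
by rewrite powR0// invr0 mul0r.
Qed.

Lemma measurable_reduced_kernel :
  measurable_fun setT (fun z : 'rV[R]_n * 'rV[R]_n => reduced_kernel z.1 z.2).
Proof.
have m1 : measurable_fun setT (fst : 'rV[R]_n * 'rV[R]_n -> _) by exact: measurable_fst.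
have m2 : measurable_fun setT (snd : 'rV[R]_n * 'rV[R]_n -> _) by exact: measurable_snd.
have minv (f : 'rV[R]_n * 'rV[R]_n -> R) t : measurable_fun setT f ->
    measurable_fun setT (fun z => (f z `^ t)^-1).
  move=> mf; under eq_fun do rewrite -powRN.
  have mp := @measurable_powR R (- t).
  by apply: (measurableT_comp mp).
have me := measurable_fun_enorm _ m1.
have mdiv (f : 'rV[R]_n * 'rV[R]_n -> R) : measurable_fun setT f ->
    measurable_fun setT (fun z => f z / enorm z.1 ^+ 2).
  move=> mf; apply: measurable_funM => //.
  by under eq_fun do rewrite -(powR_mulrn _ (enorm_ge0 _ _ _)); exact: minv.
apply: measurable_funB.
  by apply: minv; apply: measurable_fun_enorm; exact: measurable_fun_subrV.
apply: measurable_funM; first exact: minv.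
apply: measurable_sum => j; apply: measurable_sum_cond => i _.
apply: measurable_funM; last first.
  by apply: measurable_funX; apply: mdiv; exact: measurable_fun_dot.
apply: measurable_funM; first exact: measurable_cst.
apply: measurable_funX; apply: measurable_funM; first exact: measurable_cst.
by apply: mdiv; exact: measurable_fun_dot.
Qed.

End reduced_kernel.

(** The sizes of the reduced kernel in the three regions of integration: far from
the origin it has the size of the first omitted Taylor term, close to the origin
that of the last subtracted one, and in between the singularity on the diagonal
x = y shows up. *)
Definition kernel_bounds {R : realType} (n N : nat) (s : R) (p : {poly R}) (C : R) :=
  forall x y : 'rV[R]_n, 0 < enorm x ->
  [/\ 4 * enorm y <= enorm x ->
      `|reduced_kernel N s p x y| <=
        C * (enorm x `^ (- s) * (enorm y / enorm x) ^+ N.+1),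
     2 * enorm x <= enorm y ->
      `|reduced_kernel N s p x y| <=
        C * (enorm x `^ (- s) * (enorm y / enorm x) ^+ N) &
     enorm x <= 4 * enorm y ->
      `|reduced_kernel N s p x y| <=
        enorm (x - y) `^ (- s) +
        C * (enorm x `^ (- s) * (enorm y / enorm x) ^+ N)].

Lemma exists_kernel_bounds (R : realType) (n N : nat) (s : R) : 0 < s ->
  exists p : {poly R}, exists C : R, 0 <= C /\ kernel_bounds n N s p C.
Proof.
move=> s0; have [p [sp [C [C0 HC]]]] := powR1D_taylor R N.+1 (- s / 2).
exists p; set B := expansion_bound R N p; have B0 : 0 <= B := expansion_bound_ge0 R N p.
exists (C * (9 / 4) ^+ N.+1 + B + (B * 4 ^+ N + 2 `^ s)).
have C1 : 0 <= C * (9 / 4) ^+ N.+1 + B.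
  by rewrite addr_ge0// mulr_ge0// exprn_ge0// divr_ge0.
have C2 : 0 <= B * 4 ^+ N + 2 `^ s by rewrite addr_ge0 ?powR_ge0// mulr_ge0// exprn_ge0.
split; first by rewrite addr_ge0.
move=> x y x0; set X := enorm x in x0 *; set r := enorm y.
have r0 : 0 <= r := enorm_ge0 _ _ y.
pose t := r / X; pose z := dot x y / X ^+ 2.
have X0 : X != 0 by rewrite gt_eqF.
have t0 : 0 <= t by rewrite divr_ge0// ltW.
have zt : `|z| <= t.
  rewrite normrM normfV (ger0_norm (exprn_ge0 _ (ltW x0))) ler_pdivrMr ?exprn_gt0//.
  apply: le_trans (normr_dot_le _ _ _ _) _.
  by rewrite -/X -/r le_eqVlt; apply/orP; left; apply/eqP; rewrite /t; field.
have tt : dot y y / X ^+ 2 = t ^+ 2 by rewrite -enorm_sqr -/r /t exprMn exprVn.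
have kE : taylor_kernel N s p x y = X `^ (- s) * trunc_expansion R N p z (t ^+ 2).
  by rewrite /taylor_kernel -/X -/z tt powRN.
have near : X <= 4 * r -> `|taylor_kernel N s p x y| <=
    B * 4 ^+ N * (X `^ (- s) * t ^+ N).
  move=> Xr; rewrite kE normrM ger0_norm ?powR_ge0//.
  rewrite [leRHS]mulrCA ler_wpM2l ?powR_ge0//.
  apply: le_trans (trunc_expansion_le R N p z t zt _) _.
    by rewrite ler_pdivlMr// ler_pdivrMl.
  by rewrite exprMn mulrA.
have Xs0 j : 0 <= X `^ (- s) * t ^+ j by rewrite mulr_ge0 ?powR_ge0 ?exprn_ge0.
have diffE : reduced_kernel N s p x y = enorm (x - y) `^ (- s) - taylor_kernel N s p x y.
  by rewrite powRN.
split=> xy; last first.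
- rewrite diffE; apply: le_trans (ler_normB _ _) _.
  rewrite ger0_norm ?powR_ge0// lerD2l; apply: le_trans (near xy) _.
  by rewrite ler_wpM2r// addrA ler_wpDr ?powR_ge0// lerDr.
- have xy4 : X <= 4 * r by lra.
  rewrite diffE; apply: le_trans (ler_normB _ _) _.
  rewrite [leRHS]mulrDl; apply: ler_wpDl; first by rewrite mulr_ge0.
  rewrite addrC mulrDl; apply: lerD; first exact: near.
  have t1 : 1 <= t by rewrite ler_pdivlMr// mul1r; lra.
  rewrite ger0_norm ?powR_ge0// (@le_trans _ _ (2 `^ s * X `^ (- s)))//; last first.
    by rewrite ler_wpM2l ?powR_ge0// ler_peMr ?powR_ge0// exprn_ege1.
  have xyX : X <= enorm (x - y).
    by have := ler_enormB _ _ (y - x) (- x); rewrite opprK subrK enormN enormBC -/r -/X; lra.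
  rewrite (@le_trans _ _ (X `^ (- s)))//; last first.
    rewrite ler_peMl ?powR_ge0//.
    rewrite -[leLHS](powRr0 2); apply: ler_powR; last exact: ltW.
    by rewrite ler1n.
  rewrite !powRN lef_pV2 ?posrE ?powR_gt0//; last exact: lt_le_trans xyX.
  by apply: ge0_ler_powR; rewrite ?nnegrE ?enorm_ge0// ltW.
have t4 : t <= 4^-1 by rewrite ler_pdivrMr// ler_pdivlMl.
pose u := - 2 * z + t ^+ 2.
have tsq : t ^+ 2 <= 4^-1 * t by rewrite expr2 ler_wpM2r.
have ut : `|u| <= 9 / 4 * t.
  apply: le_trans (ler_normD _ _) _; rewrite normrM normrN normr_nat.
  rewrite [in X in _ + X]ger0_norm ?exprn_ge0//; lra.
(* For t <= 1/4, 2 t + t^2 <= (9/4) t <= 9/16. *)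
have u916 : `|u| <= 9 / 16 by lra.
have xyE : enorm (x - y) `^ (- s) = X `^ (- s) * (1 + u) `^ (- s / 2).
  have e2 w : 0 <= w -> w `^ (- s) = (w ^+ 2) `^ (- s / 2) :> R.
    by move=> w0; rewrite -powR_mulrn// -powRrM; congr powR; field.
  rewrite !e2 ?enorm_ge0 ?(ltW x0)// -powRM ?exprn_ge0 ?(ltW x0)//; last first.
    by move: u916; rewrite ler_norml => /andP[]; lra.
  congr powR; rewrite enormB_sqr -enorm_sqr -/X -[dot y y]enorm_sqr -/r /u /z /t.
  by field.
rewrite diffE xyE kE -mulrBr normrM ger0_norm ?powR_ge0// mulrCA ler_wpM2l ?powR_ge0//.
rewrite [leRHS]mulrDl; apply: ler_wpDr; first by rewrite mulr_ge0 ?exprn_ge0.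
rewrite mulrDl (le_trans (ler_distD p.[u] _ _))//; apply: lerD; last first.
  exact: trunc_expansion_close.
apply: le_trans (HC _ u916) _.
by rewrite -mulrA ler_wpM2l// -exprMn lerXn2r ?nnegrE// mulr_ge0// divr_ge0.
Qed.

(** The far bound with enorm y = 0; the point x = 0 is covered by the conventions
for division by zero. *)
Lemma reduced_kernel_x0 (R : realType) (n N : nat) (s : R) (p : {poly R}) (C : R) :
  0 < s -> kernel_bounds n N s p C ->
  forall x, reduced_kernel N s p x (0 : 'rV[R]_n) = 0.
Proof.
move=> s0 kb x; have e0 : enorm (0 : 'rV[R]_n) = 0 by apply/eqP; rewrite enorm_eq0.
have [->|x0] := eqVneq x 0.
  by rewrite /reduced_kernel taylor_kernel0 ?gt_eqF// sub0r enormN e0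
    powR0 ?gt_eqF// invr0 subr0.
have X0 : 0 < enorm x by rewrite lt0r enorm_eq0 x0 enorm_ge0.
have [+ _ _] := kb _ 0 X0; rewrite e0 mulr0 => /(_ (enorm_ge0 _ _ _)).
by rewrite mul0r expr0n/= !mulr0 normr_le0 => /eqP.
Qed.

(** * The weighted integral of the reduced kernel *)

Lemma powR_expR (R : realType) (t x : R) : expR x `^ t = expR (t * x).
Proof. by rewrite /powR gt_eqF ?expR_gt0// expRK. Qed.

(** Both the far and the near bounds, raised to the power q and weighted by |x| ^ b,
are monomials in |x| and |y|. *)
Lemma weighted_power (R : realType) (X r b s q : R) (M : nat) : 0 < X -> 0 < r ->
  X `^ b * (X `^ (- s) * (r / X) ^+ M) `^ q =
  r `^ (q * M%:R) * X `^ (b - q * (s + M%:R)).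
Proof.
move=> X0 r0; rewrite -(lnK X0) -(lnK r0); set u := ln X; set v := ln r.
rewrite -expRN -expRD -powR_mulrn ?expR_ge0// !powR_expR -!expRD powR_expR -expRD.
by congr expR; ring.
Qed.

(** The sum is at most twice the larger of A and B. *)
Lemma powRD_le (R : realType) (q A B : R) : 0 <= q -> 0 <= A -> 0 <= B ->
  (A + B) `^ q <= 2 `^ q * (A `^ q + B `^ q).
Proof.
move=> q0 A0 B0; rewrite mulrDr -!powRM//.
have [AB|/ltW AB] := leP A B.
  apply: ler_wpDl; first exact: powR_ge0.
  by apply: ge0_ler_powR; rewrite ?nnegrE ?addr_ge0 ?mulr_ge0//; lra.
apply: ler_wpDr; first exact: powR_ge0.
by apply: ge0_ler_powR; rewrite ?nnegrE ?addr_ge0 ?mulr_ge0//; lra.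
Qed.

Lemma measurable_EFin_powR_indic_eball (R : realType) n (c d : 'rV[R]_n) (t r : R) :
  measurable_fun setT
    (fun x : 'rV[R]_n => (enorm (x - c) `^ t * (\1_(eball d r) x : R))%:E).
Proof.
apply/measurable_EFinP; apply: measurable_funM; last first.
  by apply: measurable_indic; exact: measurable_eball.
have mp := @measurable_powR R t; apply: (measurableT_comp mp).
by apply: measurable_fun_enorm; apply: measurable_fun_subrV => //; exact: measurable_cst.
Qed.

Section reduced_kernel_integral.
Context {R : realType} (n N : nat) (s a b q : R) (p : {poly R}) (C : R).
Context (s0 : 0 < s) (q1 : 1 <= q) (sqn : s * q < n%:R)
  (nb : n%:R + b = q * (s + a)) (Na : N%:R < a) (aN : a < N.+1%:R) (C0 : 0 <= C).
Context (kb : @kernel_bounds R n N s p C).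

Let q0 : 0 < q. Proof. exact: lt_le_trans q1. Qed.

(* The three regions of kernel_bounds. The homogeneity relation nb makes each of
   these functions integrate to a multiple of |y| ^ (a q); the strict
   inequalities N < a < N + 1 give the convergence of near0 at the origin and of
   far at infinity, and s q < n that of neary at x = y. *)
Let far (y x : 'rV[R]_n) : R := enorm y `^ (q * N.+1%:R) *
  (enorm x `^ (b - q * (s + N.+1%:R)) * (\1_[set z | 4 * enorm y <= enorm z] x : R)).
Let near0 (y x : 'rV[R]_n) : R := enorm y `^ (q * N%:R) *
  (enorm (x - 0) `^ (b - q * (s + N%:R)) * (\1_(eball 0 (4 * enorm y)) x : R)).
Let neary (y x : 'rV[R]_n) : R := enorm y `^ b *
  (enorm (x - y) `^ (- s * q) * (\1_(eball y (5 * enorm y)) x : R)).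
Let D := C `^ q + 2 `^ q * ((2^-1 `^ b + 4 `^ b) + C `^ q) + 1.

Let far_ge0 y x : 0 <= far y x.
Proof. by rewrite !mulr_ge0 ?powR_ge0. Qed.
Let near0_ge0 y x : 0 <= near0 y x.
Proof. by rewrite !mulr_ge0 ?powR_ge0. Qed.
Let neary_ge0 y x : 0 <= neary y x.
Proof. by rewrite !mulr_ge0 ?powR_ge0. Qed.

Let pointwise (x y : 'rV[R]_n) : 0 < enorm y ->
  enorm x `^ b * `|reduced_kernel N s p x y| `^ q <=
  D * (far y x + (near0 y x + neary y x)).
Proof.
move=> r0; have f0 := far_ge0 y x; have g0 := near0_ge0 y x; have h0 := neary_ge0 y x.
have Cq0 : 0 <= C `^ q by exact: powR_ge0.
have E0 : 0 <= 2 `^ q * (2^-1 `^ b + 4 `^ b).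
  by rewrite mulr_ge0 ?addr_ge0 ?powR_ge0.
have F0 : 0 <= 2 `^ q * C `^ q by rewrite mulr_ge0 ?powR_ge0.
have DE : D = C `^ q + (2 `^ q * (2^-1 `^ b + 4 `^ b) + 2 `^ q * C `^ q) + 1.
  by rewrite /D mulrDr.
have D0 : 0 <= D by rewrite DE !addr_ge0.
have D1 : 1 <= D by rewrite DE lerDr !addr_ge0.
have DC : C `^ q <= D by rewrite DE -addrA lerDl !addr_ge0.
have DF : 2 `^ q * C `^ q <= D by rewrite DE -addrA ler_wpDl// -addrA ler_wpDl// lerDl.
have DG : 2 `^ q * (2^-1 `^ b + 4 `^ b) <= D.
  by rewrite DE -addrA ler_wpDl// -addrA lerDl addr_ge0.
have fG : far y x <= far y x + (near0 y x + neary y x) by rewrite lerDl addr_ge0.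
have gG : near0 y x <= far y x + (near0 y x + neary y x) by rewrite ler_wpDl// lerDl.
have hG : near0 y x + neary y x <= far y x + (near0 y x + neary y x) by rewrite lerDr.
have [x0|x0] := eqVneq x 0.
  have ex0 : enorm (0 : 'rV[R]_n) = 0 by apply/eqP; rewrite enorm_eq0.
  subst x; rewrite ex0; have [b0|b0] := eqVneq b 0; last first.
    rewrite powR0// mul0r; apply: mulr_ge0 => //.
    exact: le_trans fG.
  have nE : neary y 0 = `|reduced_kernel N s p 0 y| `^ q.
    rewrite /neary b0 powRr0 mul1r indicE mem_set ?mulr1; last first.
      by rewrite /eball/= sub0r enormN ler_peMl ?enorm_ge0// ler1n.
    rewrite /reduced_kernel taylor_kernel0 ?gt_eqF// subr0 sub0r enormN -powRN.
    by rewrite ger0_norm ?powR_ge0// powRrM.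
  rewrite b0 powRr0 mul1r -[leLHS]mul1r -nE; apply: ler_pM => //.
  by apply: le_trans hG; rewrite lerDr.
have X0 : 0 < enorm x by rewrite lt0r enorm_eq0 x0 enorm_ge0.
have [H1 H2 H3] := kb _ y X0.
have q0' := ltW q0.
have T M : enorm x `^ b * (C * (enorm x `^ (- s) * (enorm y / enorm x) ^+ M)) `^ q =
    C `^ q * (enorm y `^ (q * M%:R) * enorm x `^ (b - q * (s + M%:R))).
  rewrite powRM// ?mulr_ge0 ?powR_ge0 ?exprn_ge0 ?divr_ge0 ?enorm_ge0//.
  by rewrite mulrCA weighted_power.
have up K : `|reduced_kernel N s p x y| <= K ->
    enorm x `^ b * `|reduced_kernel N s p x y| `^ q <= enorm x `^ b * K `^ q.
  move=> h; rewrite ler_wpM2l ?powR_ge0//; have K0 := le_trans (normr_ge0 _) h.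
  by apply: ge0_ler_powR; rewrite ?nnegrE.
have [h|h] := leP (4 * enorm y) (enorm x).
  apply: le_trans (up _ (H1 h)) _; rewrite T.
  have -> : enorm y `^ (q * N.+1%:R) * enorm x `^ (b - q * (s + N.+1%:R)) = far y x.
    by rewrite /far indicE mem_set ?mulr1.
  by apply: ler_pM.
have n0E : enorm y `^ (q * N%:R) * enorm x `^ (b - q * (s + N%:R)) = near0 y x.
  by rewrite /near0 indicE mem_set ?mulr1 ?subr0// /eball/= subr0 ltW.
have [h'|/ltW h'] := leP (2 * enorm x) (enorm y).
  apply: le_trans (up _ (H2 h')) _; rewrite T n0E.
  by apply: ler_pM.
apply: le_trans (up _ (H3 (ltW h))) _.
set B := C * _; have B0 : 0 <= B.
  by rewrite !mulr_ge0 ?powR_ge0 ?exprn_ge0 ?divr_ge0 ?enorm_ge0.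
apply: le_trans (ler_wpM2l (powR_ge0 _ _) (powRD_le _ _ _ _ q0' (powR_ge0 _ _) B0)) _.
rewrite mulrCA mulrDr T n0E -powRrM.
have Xb : enorm x `^ b <= (2^-1 `^ b + 4 `^ b) * enorm y `^ b.
  rewrite mulrDl -!powRM ?enorm_ge0//; apply: powR_le_ends.
    by rewrite mulr_gt0.
  by rewrite ler_pdivrMl// h' ltW.
have : enorm x `^ b * enorm (x - y) `^ (- s * q) <= (2^-1 `^ b + 4 `^ b) * neary y x.
  rewrite /neary indicE mem_set ?mulr1; last first.
    rewrite /eball/=; apply: le_trans (ler_enormB _ _ x y) _.
    by rewrite (_ : 5 * _ = 4 * enorm y + enorm y) ?lerD2r ?ltW//; ring.
  by rewrite mulrA ler_wpM2r ?powR_ge0.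
have E2 : 0 <= 2^-1 `^ b + 4 `^ b by rewrite addr_ge0 ?powR_ge0.
have P2 : 0 <= 2 `^ q := powR_ge0 _ _.
set u := enorm x `^ b * _; set w := 2^-1 `^ b + 4 `^ b in DE E0 E2 DG *.
move=> uw.
rewrite (@le_trans _ _ (2 `^ q * w * neary y x + 2 `^ q * C `^ q * near0 y x))//.
  by rewrite mulrDr -!mulrA lerD2r ler_wpM2l.
apply: le_trans (lerD (ler_wpM2r h0 DG) (ler_wpM2r g0 DF)) _.
by rewrite -mulrDr ler_wpM2l// addrC.
Qed.

Let int_far : exists K : R, 0 <= K /\ forall y, 0 < enorm y ->
  (\int[lebesgue_rV n]_x (far y x)%:E <= (K * enorm y `^ (a * q))%:E)%E.
Proof.
have [|K [K0 HK]] := @integral_powR_far R n (b - q * (s + N.+1%:R)).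
  have -> : n%:R + (b - q * (s + N.+1%:R)) = q * (a - N.+1%:R) by rewrite addrA nb; ring.
  by rewrite pmulr_rlt0// subr_lt0.
exists (K * 4 `^ (q * (a - N.+1%:R))); split; first by rewrite mulr_ge0 ?powR_ge0.
move=> y r0; rewrite /far; under eq_integral do rewrite EFinM.
rewrite ge0_integralZl_EFin ?powR_ge0//; last 2 first.
- by move=> x _; rewrite lee_fin mulr_ge0 ?powR_ge0.
- apply/measurable_EFinP/measurable_funM.
    apply: (measurableT_comp (@measurable_powR R _)).
    by apply: measurable_fun_enorm; exact: measurable_id.
  apply: measurable_indic; apply: measurable_set_ge.
  by apply: measurable_fun_enorm; exact: measurable_id.
apply: le_trans (lee_wpmul2l _ (HK _ _)) _; first by rewrite lee_fin powR_ge0.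
  by rewrite mulr_gt0.
rewrite -EFinM lee_fin.
have -> : n%:R + (b - q * (s + N.+1%:R)) = q * (a - N.+1%:R) by rewrite addrA nb; ring.
rewrite powRM ?enorm_ge0// -(lnK r0) !powR_expR.
rewrite mulrC -!mulrA ler_wpM2l// ler_wpM2l ?powR_ge0// -expRD.
by rewrite le_eqVlt; apply/orP; left; apply/eqP; congr expR; ring.
Qed.

Let int_near0 : exists K : R, 0 <= K /\ forall y, 0 < enorm y ->
  (\int[lebesgue_rV n]_x (near0 y x)%:E <= (K * enorm y `^ (a * q))%:E)%E.
Proof.
have tE : n%:R + (b - q * (s + N%:R)) = q * (a - N%:R) by rewrite addrA nb; ring.
have [|K [K0 HK]] := @integral_powR_near R n (b - q * (s + N%:R)).
  by rewrite tE mulr_gt0// subr_gt0.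
exists (K * 4 `^ (q * (a - N%:R))); split; first by rewrite mulr_ge0 ?powR_ge0.
move=> y r0; rewrite /near0; under eq_integral do rewrite EFinM.
rewrite ge0_integralZl_EFin ?powR_ge0//; last 2 first.
- by move=> x _; rewrite lee_fin mulr_ge0 ?powR_ge0.
- exact: measurable_EFin_powR_indic_eball.
apply: le_trans (lee_wpmul2l _ (HK _ _ _)) _; first by rewrite lee_fin powR_ge0.
  by rewrite mulr_gt0.
rewrite -EFinM lee_fin tE powRM ?enorm_ge0// -(lnK r0) !powR_expR.
rewrite mulrC -!mulrA ler_wpM2l// ler_wpM2l ?powR_ge0// -expRD.
by rewrite le_eqVlt; apply/orP; left; apply/eqP; congr expR; ring.
Qed.

Let int_neary : exists K : R, 0 <= K /\ forall y, 0 < enorm y ->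
  (\int[lebesgue_rV n]_x (neary y x)%:E <= (K * enorm y `^ (a * q))%:E)%E.
Proof.
have [|K [K0 HK]] := @integral_powR_near R n (- s * q).
  by rewrite mulNr subr_gt0.
exists (K * 5 `^ (n%:R + - s * q)); split; first by rewrite mulr_ge0 ?powR_ge0.
move=> y r0; rewrite /neary; under eq_integral do rewrite EFinM.
rewrite ge0_integralZl_EFin ?powR_ge0//; last 2 first.
- by move=> x _; rewrite lee_fin mulr_ge0 ?powR_ge0.
- exact: measurable_EFin_powR_indic_eball.
apply: le_trans (lee_wpmul2l _ (HK _ _ _)) _; first by rewrite lee_fin powR_ge0.
  by rewrite mulr_gt0.
rewrite -EFinM lee_fin powRM ?enorm_ge0// -(lnK r0) !powR_expR.
rewrite mulrC -!mulrA ler_wpM2l// ler_wpM2l ?powR_ge0// -expRD.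
rewrite le_eqVlt; apply/orP; left; apply/eqP; congr expR.
have bE : b = q * (s + a) - n%:R by rewrite -nb; ring.
by rewrite bE; ring.
Qed.

(** This is where the exponents matter: the three dominating functions are
integrated with integral_powR_near and integral_powR_far. *)
Lemma reduced_kernel_integral : exists K : R, 0 <= K /\ forall y : 'rV[R]_n,
  (\int[lebesgue_rV n]_x (enorm x `^ b * `|reduced_kernel N s p x y| `^ q)%:E
   <= (K * enorm y `^ (a * q))%:E)%E.
Proof.
have [K1 [K10 H1]] := int_far; have [K2 [K20 H2]] := int_near0.
have [K3 [K30 H3]] := int_neary.
have D0 : 0 <= D by rewrite !addr_ge0 ?mulr_ge0 ?addr_ge0 ?powR_ge0.
have DK0 : 0 <= D * (K1 + (K2 + K3)) by apply: mulr_ge0 => //; rewrite !addr_ge0.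
exists (D * (K1 + (K2 + K3))); split => //.
move=> y; have [->|y0] := eqVneq y 0.
  rewrite integral0_eq; first by rewrite lee_fin; apply: mulr_ge0 => //; exact: powR_ge0.
  move=> x _; rewrite (reduced_kernel_x0 _ _ _ _ _ _ s0 kb).
  by rewrite normr0 powR0 ?mulr0// gt_eqF.
have r0 : 0 < enorm y by rewrite lt0r enorm_eq0 y0 enorm_ge0.
apply: (@le_trans _ _ (\int[lebesgue_rV n]_x (D%:E * ((far y x)%:E + ((near0 y x)%:E + (neary y x)%:E))))%E).
  apply: ge0_le_integral_nomeas => x; first by rewrite lee_fin mulr_ge0 ?powR_ge0.
  by rewrite -!EFinD -EFinM lee_fin; exact: pointwise.
have mf : measurable_fun setT (fun x => (far y x)%:E).
  apply/measurable_EFinP; apply: measurable_funM => //; apply: measurable_funM.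
    apply: (measurableT_comp (@measurable_powR R _)).
    by apply: measurable_fun_enorm; exact: measurable_id.
  apply: measurable_indic; apply: measurable_set_ge.
  by apply: measurable_fun_enorm; exact: measurable_id.
have m0 : measurable_fun setT (fun x => (near0 y x)%:E).
  apply/measurable_EFinP; apply: measurable_funM => //.
  by apply/measurable_EFinP; exact: measurable_EFin_powR_indic_eball.
have my : measurable_fun setT (fun x => (neary y x)%:E).
  apply/measurable_EFinP; apply: measurable_funM => //.
  by apply/measurable_EFinP; exact: measurable_EFin_powR_indic_eball.
have m0y := emeasurable_funD m0 my.
have f0 x : setT x -> (0 <= (far y x)%:E)%E by rewrite lee_fin.
have g0 x : setT x -> (0 <= (near0 y x)%:E)%E by rewrite lee_fin.
have h0 x : setT x -> (0 <= (neary y x)%:E)%E by rewrite lee_fin.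
rewrite ge0_integralZl_EFin//; last 2 first.
- by move=> x _; rewrite !adde_ge0// lee_fin.
- exact: emeasurable_funD.
rewrite ge0_integralD//; last by move=> x _; rewrite adde_ge0// lee_fin.
rewrite ge0_integralD//.
rewrite -mulrA EFinM; apply: lee_wpmul2l => //.
rewrite !mulrDl !EFinD; apply: leeD; first exact: H1.
by apply: leeD; [exact: H2|exact: H3].
Qed.

End reduced_kernel_integral.

(** * Polynomials annihilated by vanishing moments *)

Section polynomial_functions.
Context {R : realType} {n : nat}.
Implicit Types (N M : nat) (g h : 'rV[R]_n -> R) (y : 'rV[R]_n).

Definition monomial (gamma : 'I_n -> nat) y : R := \prod_(i < n) y ord0 i ^+ gamma i.

(** Polynomial functions of degree at most N, with the explicit list of their
monomials: moments are tested on monomials. *)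
Definition polyfun N g := exists2 l : seq (R * {ffun 'I_n -> nat}),
  (forall t, t \in l -> (\sum_i t.2 i <= N)%N) &
  forall y, g y = \sum_(t <- l) t.1 * monomial t.2 y.

Lemma polyfunW N M g : (N <= M)%N -> polyfun N g -> polyfun M g.
Proof. by move=> NM [l lN gE]; exists l => // t /lN /leq_trans; apply. Qed.

Lemma polyfun_cst N c : polyfun N (fun=> c).
Proof.
exists [:: (c, [ffun=> 0%N])] => [t|y]; rewrite ?inE ?big_seq1.
  by move=> /eqP ->; rewrite big1// => i _; rewrite ffunE.
by rewrite /monomial big1 ?mulr1// => i _; rewrite ffunE expr0.
Qed.

Lemma polyfun_coor i : polyfun 1 (fun y => y ord0 i).
Proof.
exists [:: (1, [ffun j => (j == i) : nat])] => [t|y]; rewrite ?inE ?big_seq1.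
  move=> /eqP -> /=; rewrite (bigD1 i)//= ffunE eqxx big1// => j ji.
  by rewrite ffunE (negbTE ji).
rewrite /monomial mul1r (bigD1 i)//= ffunE eqxx expr1 big1 ?mulr1// => j ji.
by rewrite ffunE (negbTE ji) expr0.
Qed.

Lemma polyfunD N g h : polyfun N g -> polyfun N h -> polyfun N (fun y => g y + h y).
Proof.
move=> [l lN gE] [k kN hE]; exists (l ++ k) => [t|y].
  by rewrite mem_cat => /orP[/lN|/kN].
by rewrite big_cat/= gE hE.
Qed.

Lemma polyfunM N M g h :
  polyfun N g -> polyfun M h -> polyfun (N + M) (fun y => g y * h y).
Proof.
move=> [l lN gE] [k kM hE].
exists [seq (t.1 * u.1, [ffun i => (t.2 i + u.2 i)%N]) |
  t : R * {ffun 'I_n -> nat} <- l, u : R * {ffun 'I_n -> nat} <- k] => [t|y].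
  move=> /allpairsP[[u v] /= [ul vk ->]] /=.
  under eq_bigr do rewrite ffunE.
  by rewrite big_split/= leq_add ?lN ?kM.
rewrite gE hE big_allpairs_dep/= mulr_suml; apply: eq_bigr => u _.
rewrite mulr_sumr; apply: eq_bigr => v _.
rewrite mulrACA; congr (_ * _); rewrite /monomial -big_split/=.
by apply: eq_bigr => i _; rewrite ffunE exprD.
Qed.

Lemma polyfunX N j g : polyfun N g -> polyfun (j * N) (fun y => g y ^+ j).
Proof.
move=> gN; elim: j => [|j IH]; first exact: (polyfun_cst _ 1).
by rewrite mulSn; under eq_fun do rewrite exprS; exact: polyfunM.
Qed.

Lemma polyfun_sum N (I : Type) (r : seq I) (P : pred I) (G : I -> 'rV[R]_n -> R) :
  (forall i, P i -> polyfun N (G i)) ->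
  polyfun N (fun y => \sum_(i <- r | P i) G i y).
Proof.
move=> GN; elim: r => [|i r IH].
  by under eq_fun do rewrite big_nil; exact: polyfun_cst.
under eq_fun do rewrite big_cons.
by case: (boolP (P i)) => // Pi; apply: polyfunD => //; exact: GN.
Qed.

Lemma polyfun_dotl x : polyfun 1 (dot x).
Proof.
by apply: polyfun_sum => i _; apply: (polyfunM 0 1); [exact: polyfun_cst|exact: polyfun_coor].
Qed.

Lemma polyfun_dotxx : polyfun 2 (fun y => dot y y).
Proof. by apply: polyfun_sum => i _; apply: (polyfunM 1 1); exact: polyfun_coor. Qed.

(** Here the condition i + j <= N of trunc_expansion is used. *)
Lemma polyfun_taylor_kernel N (s : R) p x : polyfun N (taylor_kernel N s p x).
Proof.
apply: (polyfunM 0 N); first exact: polyfun_cst.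
apply: polyfun_sum => j _; apply: polyfun_sum => i ijN.
apply: (polyfunW (j - i + i * 2)).
  by apply: leq_trans ijN; rewrite muln2 -addnn addnA subnK ?leq_addr// 1?addnC// -ltnS.
apply: polyfunM; last first.
  by apply: polyfunX; apply: (polyfunM 2 0); [exact: polyfun_dotxx|exact: polyfun_cst].
apply: (polyfunM 0); first exact: polyfun_cst.
rewrite -[X in polyfun X]muln1; apply: polyfunX; apply: (polyfunM 0 1).
  exact: polyfun_cst.
by apply: (polyfunM 1 0); [exact: polyfun_dotl|exact: polyfun_cst].
Qed.

Lemma measurable_monomial gamma : measurable_fun setT (monomial gamma).
Proof.
apply: measurable_prod => i _; apply: measurable_funX.
exact: measurable_rV_coor.
Qed.

Lemma measurable_polyfun N g : polyfun N g -> measurable_fun setT g.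
Proof.
move=> [l _ gE]; rewrite (funext gE); apply: measurable_sum => t.
by apply: measurable_funM; [exact: measurable_cst|exact: measurable_monomial].
Qed.

Lemma polyfun_bounded N g r : polyfun N g ->
  exists B, forall y, enorm y <= r -> `|g y| <= B.
Proof.
move=> [l _ gE]; exists (\sum_(t <- l) `|t.1| * \prod_(i < n) r ^+ t.2 i) => y yr.
rewrite gE; apply: le_trans (ler_norm_sum _ _ _) _; apply: ler_sum => t _.
rewrite normrM ler_wpM2l// /monomial normr_prod; apply: ler_prod => i _.
rewrite normrX exprn_ge0//= lerXn2r ?nnegrE//.
  by apply: le_trans yr; exact: enorm_ge0.
by apply: le_trans yr; exact: normr_coor_le.
Qed.

End polynomial_functions.

Section compactly_supported.
Context {R : realType} {n : nat} (phi : 'rV[R]_n -> R) (rho B : R).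
Context (mphi : measurable_fun setT phi) (rho0 : 0 < rho)
  (phiB : forall y, `|phi y| <= B)
  (phi_supp : forall y, phi y != 0 -> enorm y <= rho).

Let B0 : 0 <= B.
Proof. exact: le_trans (phiB 0). Qed.

Lemma integrable_polyfun N g : polyfun N g ->
  (lebesgue_rV n).-integrable setT (EFin \o (fun y => g y * phi y)).
Proof.
move=> gN; have [A gA] := polyfun_bounded N g rho gN.
have A0 : 0 <= A.
  apply: le_trans (gA 0 _) => //.
  by have /eqP -> : enorm (0 : 'rV[R]_n) == 0 by [rewrite enorm_eq0]; exact: ltW.
apply: (@le_integrable _ _ _ _ _ measurableT _ (fun y : 'rV[R]_n => (A * B)%:E * (\1_(eball 0 rho) y)%:E)%E).
- by apply/measurable_EFinP; apply: measurable_funM => //; exact: (measurable_polyfun N).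
- move=> y _; rewrite /= -?EFinM ?abse_EFin lee_fin normrM.
  have [->|/phi_supp yr] := eqVneq (phi y) 0; first by rewrite normr0 mulr0.
  rewrite indicE mem_set ?mulr1; last by rewrite /eball/= subr0.
  by rewrite [leRHS]ger0_norm ?mulr_ge0// ler_pM// gA.
apply: integrableZl => //; apply/integrableP; split.
  by apply/measurable_EFinP/measurable_indic; exact: measurable_eball.
under eq_integral do rewrite abse_EFin ger0_norm//.
rewrite integral_indic ?setIT//; last exact: measurable_eball.
by apply: le_lt_trans (lebesgue_eball_le _ _ _ _ (ltW rho0)) _; rewrite ltry.
Qed.

(** The kernel is locally integrable because s < n, and phi is bounded and vanishes
outside a ball. *)
Lemma integrable_riesz_kernel (s : R) (x : 'rV[R]_n) : s < n%:R ->
  (lebesgue_rV n).-integrable setT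
    (EFin \o (fun y => (enorm (x - y) `^ s)^-1 * phi y)).
Proof.
move=> sn; have [|C [C0 HC]] := @integral_powR_near R n (- s); first by rewrite subr_gt0.
have rx0 : 0 < rho + enorm x by rewrite ltr_pwDl// enorm_ge0.
have mk : measurable_fun setT (fun y : 'rV[R]_n => (enorm (x - y) `^ s)^-1).
  under eq_fun do rewrite -powRN.
  have mp := @measurable_powR R (- s); apply: (measurableT_comp mp).
  by apply: measurable_fun_enorm; apply: measurable_fun_subrV => //; exact: measurable_cst.
have mi : measurable_fun setT (fun y : 'rV[R]_n =>
    enorm (y - x) `^ (- s) * (\1_(eball x (rho + enorm x)) y : R)).
  apply: measurable_funM; last by apply: measurable_indic; exact: measurable_eball.
  by under eq_fun do rewrite enormBC powRN.
apply: (@le_integrable _ _ _ _ _ measurableT _ (fun y : 'rV[R]_n => B%:E *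
    (enorm (y - x) `^ (- s) * (\1_(eball x (rho + enorm x)) y : R))%:E)%E).
- by apply/measurable_EFinP; exact: measurable_funM.
- move=> y _; rewrite /= -?EFinM ?abse_EFin lee_fin normrM -powRN (enormBC _ _ x y).
  have [->|/phi_supp yr] := eqVneq (phi y) 0; first by rewrite normr0 mulr0.
  rewrite indicE mem_set ?mulr1; last first.
    by rewrite /eball/=; apply: le_trans (ler_enormB _ _ _ _) _; rewrite lerD2r.
  by rewrite normrM mulrC ler_wpM2r// (ger0_norm B0).
apply: integrableZl => //; apply/integrableP; split; first exact/measurable_EFinP.
under eq_integral do rewrite abse_EFin ger0_norm ?mulr_ge0 ?powR_ge0//.
by apply: le_lt_trans (HC _ _ rx0) _; rewrite ltry.
Qed.

Lemma Rintegral_polyfun_eq0 N g : polyfun N g ->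
  (forall gamma : 'I_n -> nat, (\sum_i gamma i <= N)%N ->
    \int[lebesgue_rV n]_y (monomial gamma y * phi y) = 0) ->
  \int[lebesgue_rV n]_y (g y * phi y) = 0.
Proof.
move=> [l lN gE] vanish.
under eq_Rintegral do rewrite gE mulr_suml.
elim: l lN {gE} => [|t l IH] lN.
  by under eq_Rintegral do rewrite big_nil; rewrite /Rintegral integral0.
under eq_Rintegral do rewrite big_cons -mulrA.
have tN : (\sum_i t.2 i <= N)%N by apply: lN; rewrite mem_head.
have lN' u : u \in l -> (\sum_i u.2 i <= N)%N by move=> ul; apply: lN; rewrite inE ul orbT.
have it : (lebesgue_rV n).-integrable setT (EFin \o (fun y => monomial t.2 y * phi y)).
  apply: (integrable_polyfun N); exists [:: (1, t.2)] => [u|y].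
    by rewrite inE => /eqP ->.
  by rewrite big_seq1 mul1r.
rewrite RintegralD//.
- by rewrite RintegralZl// vanish// mulr0 add0r; exact: IH.
- rewrite (_ : _ \o _ = (fun y => t.1%:E * (monomial t.2 y * phi y)%:E)%E).
    exact: integrableZl.
  by apply/funext => y.
- have pl : polyfun N (fun y => \sum_(u <- l) u.1 * monomial u.2 y) by exists l.
  have := integrable_polyfun _ _ pl; apply: eq_integrable => // y _ /=.
  by rewrite mulr_suml.
Qed.

(** Vanishing moments allow any polynomial of degree at most N in y to be subtracted
from the kernel, in particular taylor_kernel. *)
Lemma Rintegral_reduced_kernel (N : nat) (s : R) p (x : 'rV[R]_n) : s < n%:R ->
  (forall gamma : 'I_n -> nat, (\sum_i gamma i <= N)%N ->
    \int[lebesgue_rV n]_y (monomial gamma y * phi y) = 0) ->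
  (`|\int[lebesgue_rV n]_y ((enorm (x - y) `^ s)^-1 * phi y)|%:E <=
   \int[lebesgue_rV n]_y (`|reduced_kernel N s p x y| * `|phi y|)%:E)%E.
Proof.
move=> sn vanish.
have pt := polyfun_taylor_kernel N s p x.
have it := integrable_polyfun _ _ pt.
have ik := integrable_riesz_kernel s x sn.
have -> : \int[lebesgue_rV n]_y ((enorm (x - y) `^ s)^-1 * phi y) =
    \int[lebesgue_rV n]_y (reduced_kernel N s p x y * phi y).
  under [RHS]eq_Rintegral do rewrite mulrBl.
  by rewrite RintegralB// (Rintegral_polyfun_eq0 _ _ pt)// subr0.
have ir : (lebesgue_rV n).-integrable setT
    (EFin \o (fun y => reduced_kernel N s p x y * phi y)).
  have := integrableB measurableT ik it; apply: eq_integrable => // y _ /=.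
  by rewrite -EFinB -mulrBl.
apply: le_trans (_ : _ <= (\int[lebesgue_rV n]_y `|reduced_kernel N s p x y * phi y|)%:E)%E _.
  by rewrite lee_fin le_normr_Rintegral.
rewrite /Rintegral fineK; first by under eq_integral do rewrite normrM.
apply: integrable_fin_num => //.
exact: integrable_norm.
Qed.

End compactly_supported.

(** * Hoelder's inequality and vector-valued functions *)

Lemma le_poweR (R : realType) (r : R) (x y : \bar R) : 0 <= r ->
  (0 <= x)%E -> (x <= y)%E -> (x `^ r <= y `^ r)%E.
Proof.
move=> r0 x0 xy; apply: gt0_ler_poweR => //; rewrite in_itv/= leey andbT//.
exact: le_trans xy.
Qed.

(** Hoelder's inequality for H w^(1/q) and w^(1 - 1/q). It replaces Minkowski's
integral inequality: combined with Tonelli's theorem, it moves the L^q norm in x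
under the integral in y. *)
Lemma weighted_hoelder d (T : measurableType d) (R : realType)
    (mu : {measure set T -> \bar R}) (H w : T -> R) (q : R) :
  1 <= q -> measurable_fun setT H -> measurable_fun setT w ->
  (forall x, 0 <= H x) -> (forall x, 0 <= w x) ->
  ((\int[mu]_x (H x * w x)%:E) `^ q <=
   (\int[mu]_x (w x)%:E) `^ (q - 1) * \int[mu]_x (H x `^ q * w x)%:E)%E.
Proof.
move=> q1 mH mw H0 w0; have q0 : 0 < q := lt_le_trans ltr01 q1.
move: q1; rewrite le_eqVlt => /predU1P[<-|q1].
  rewrite subrr poweRe0 mul1e poweRe1; last first.
    by apply: integral_ge0 => x _; rewrite lee_fin mulr_ge0.
  by under [X in (_ <= X)%E]eq_integral do rewrite powRr1//.
have q1' : 0 < q - 1 by rewrite subr_gt0.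
(* p is the exponent conjugate to q. *)
pose p := q / (q - 1).
have p0 : 0 < p by rewrite divr_gt0.
have pq : q^-1 + p^-1 = 1 by rewrite /p invf_div; field; rewrite gt_eqF.
pose f x := H x * w x `^ q^-1; pose g x := w x `^ p^-1.
have mwp r : measurable_fun setT (fun x => w x `^ r).
  by have mp := @measurable_powR R r; apply: (measurableT_comp mp).
have mf : measurable_fun setT f by exact: measurable_funM.
have f0 x : 0 <= f x by rewrite mulr_ge0 ?powR_ge0.
have N1 : ('N[mu]_1[EFin \o (f \* g)%R] = \int[mu]_x (H x * w x)%:E)%E.
  rewrite Lnorm1; apply: eq_integral => x _ /=.
  rewrite ger0_norm ?mulr_ge0 ?powR_ge0// /f /g -mulrA.
  by rewrite -powRD pq ?oner_eq0// powRr1.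
have Nq : ('N[mu]_q%:E[EFin \o f] = (\int[mu]_x (H x `^ q * w x)%:E) `^ q^-1)%E.
  rewrite unlock; congr (_ `^ _)%E; apply: eq_integral => x _ /=.
  rewrite (ger0_norm (f0 x)) /f powRM ?powR_ge0// -powRrM.
  by rewrite mulVf ?gt_eqF// powRr1.
have Np : ('N[mu]_p%:E[EFin \o g] = (\int[mu]_x (w x)%:E) `^ p^-1)%E.
  rewrite unlock; congr (_ `^ _)%E; apply: eq_integral => x _ /=.
  rewrite ger0_norm ?powR_ge0// /g -powRrM.
  by rewrite mulVf ?gt_eqF// powRr1.
have h := hoelder mu mf (mwp p^-1) q0 p0 pq; rewrite N1 Nq Np in h.
have Hw0 : (0 <= \int[mu]_x (H x * w x)%:E)%E.
  by apply: integral_ge0 => x _; rewrite lee_fin mulr_ge0.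
apply: le_trans (le_poweR _ _ _ _ (ltW q0) Hw0 h) _.
rewrite poweRM ?poweR_ge0// -!poweRrM mulVf ?gt_eqF// poweRe1; last first.
  by apply: integral_ge0 => x _; rewrite lee_fin mulr_ge0 ?powR_ge0.
by rewrite muleC (_ : p^-1 * q = q - 1)// /p invf_div -mulrA mulVf ?mulr1// gt_eqF.
Qed.

Section valued.
Context {R : realType} {E : vectType R} {m : nat} (e : m.-tuple E) {n : nat}.
Context (he : basis_of {:E} e).

Lemma coord_vintegral (g : 'rV[R]_n -> E) j :
  coord e j (vintegral e g) = \int[lebesgue_rV n]_x coord e j (g x).
Proof.
have fe := basis_free he.
rewrite /vintegral linear_sum (bigD1 j)//= linearZ/= coord_free// eqxx mulr1.
rewrite big1 ?addr0// => i ij.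
by rewrite linearZ/= coord_free// (negbTE ij) mulr0.
Qed.

Lemma normr_coord_le_vnorm v j : `|coord e j v| <= vnorm e v.
Proof.
by have := normr_coor_le _ _ (\row_(i < m) coord e i v) j; rewrite mxE.
Qed.

Lemma vnorm_le_sum v : vnorm e v <= \sum_(j < m) `|coord e j v|.
Proof.
have := enorm_le_sum _ _ (\row_(i < m) coord e i v).
by under eq_bigr do rewrite mxE.
Qed.

Lemma continuous_compact_bounded (K : set 'rV[R]_n) (g : 'rV[R]_n -> R) :
  compact K -> continuous g -> exists B, 0 <= B /\ forall x, K x -> `|g x| <= B.
Proof.
move=> cK cg.
have /compact_bounded[M [_ HM]] := continuous_compact (continuous_subspaceT cg) cK.
exists (`|M| + 1); split; first by rewrite addr_ge0.
move=> x Kx; apply: (HM (`|M| + 1)); last by exists x.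
by rewrite ltr_pwDr// ler_norm.
Qed.

Lemma compact_enorm_bounded (K : set 'rV[R]_n) : compact K ->
  exists r, 0 < r /\ forall x, K x -> enorm x <= r.
Proof.
move=> cK.
have /choice[B HB] : forall i : 'I_n, exists B, 0 <= B /\
    forall x, K x -> `|x ord0 i| <= B.
  by move=> i; apply: continuous_compact_bounded => //; exact: coord_continuous.
exists (1 + \sum_i B i); split.
  by rewrite ltr_pwDl// sumr_ge0// => i _; have [] := HB i.
move=> x Kx; apply: le_trans (enorm_le_sum _ _ _) _.
rewrite ler_wpDl//; apply: ler_sum => i _; have [_] := HB i; exact.
Qed.

Context (f : 'rV[R]_n -> E) (hf : Cc_infty e f).

Lemma Cc_infty_continuous j : continuous (fun x => coord e j (f x)).
Proof. by have [/(_ j)/(_ [::])[]] := hf. Qed.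

Lemma Cc_infty_support : exists r, 0 < r /\ forall x j, coord e j (f x) != 0 -> enorm x <= r.
Proof.
have [_ /compact_enorm_bounded[r [r0 H]]] := hf; exists r; split => // x j fx.
apply: H; apply: subset_closure => /=; apply: contra fx => /eqP ->.
by rewrite linear0.
Qed.

Lemma Cc_infty_bounded j : exists B, forall x, `|coord e j (f x)| <= B.
Proof.
have [_ cK] := hf.
have [B [B0 H]] := continuous_compact_bounded _ _ cK (Cc_infty_continuous j).
exists B => x; have [fx|fx] := eqVneq (f x) 0; first by rewrite fx linear0 normr0.
by apply: H; apply: subset_closure.
Qed.

Lemma measurable_vnorm : measurable_fun setT (fun x => vnorm e (f x)).
Proof.
apply: measurable_fun_enorm; apply: measurable_fun_rV => j.
rewrite (_ : _ \o _ = (fun x => coord e j (f x))); last first.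
  by apply/funext => x; rewrite /= /rV_coor mxE.
by apply: continuous_measurable_rV; exact: Cc_infty_continuous.
Qed.

Lemma vanishing_coord (N : nat) : vanishing_moments e N f ->
  forall j (gamma : 'I_n -> nat), (\sum_i gamma i <= N)%N ->
  \int[lebesgue_rV n]_y (monomial gamma y * coord e j (f y)) = 0.
Proof.
move=> vm j gamma gN.
have := congr1 (coord e j) (vm gamma gN).
rewrite coord_vintegral linear0 => <-.
by apply: eq_Rintegral => y _; rewrite linearZ.
Qed.

(** The potential is replaced by the reduced kernel coordinate by coordinate; each
of the m coordinates is at most the norm, whence the factor m. *)
Lemma vnorm_riesz_le (N : nat) (k : R) (p : {poly R}) (x : 'rV[R]_n) :
  0 < k -> vanishing_moments e N f ->
  ((vnorm e (riesz_potential e k f x))%:E <=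
   m%:R%:E * \int[lebesgue_rV n]_y
      (`|reduced_kernel N (n%:R - k) p x y| * vnorm e (f y))%:E)%E.
Proof.
move=> k0 vm; set s := n%:R - k.
have sn : s < n%:R by rewrite /s ltrBlDr ltrDl.
have mk : measurable_fun setT (fun y => `|reduced_kernel N s p x y|).
  apply: measurableT_comp => //.
  exact: (measurableT_comp (measurable_reduced_kernel N s p) (measurable_pair1 x)).
have [r [r0 supp]] := Cc_infty_support.
apply: (@le_trans _ _ (\sum_(j < m) (`|coord e j (riesz_potential e k f x)|)%:E)%E).
  by rewrite sumEFin lee_fin vnorm_le_sum.
rewrite (_ : m%:R%:E = \sum_(j < m) 1)%E; last by rewrite sumEFin sumr_const card_ord.
rewrite ge0_sume_distrl//.
apply: lee_sum => j _; rewrite mul1e.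
rewrite coord_vintegral (_ : \int[_]_y _ =
    \int[lebesgue_rV n]_y ((enorm (x - y) `^ s)^-1 * coord e j (f y))); last first.
  by apply: eq_Rintegral => y _; rewrite linearZ.
have [B HB] := Cc_infty_bounded j.
have mfj : measurable_fun setT (fun y => coord e j (f y)).
  by apply: continuous_measurable_rV; exact: Cc_infty_continuous.
apply: le_trans (Rintegral_reduced_kernel _ _ _ mfj r0 HB (fun y => supp y j) N s p x sn _) _.
  exact: vanishing_coord.
apply: ge0_le_integral_nomeas => y; first by rewrite lee_fin mulr_ge0.
by rewrite lee_fin ler_wpM2l// normr_coord_le_vnorm.
Qed.

End valued.

(** * The weighted inequality for the Riesz potential *)

Theorem theorem1p1 (R : realType)
    (E : vectType R) (m : nat) (e : m.-tuple E) (he : basis_of {:E} e)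
    (n : nat) (hn : (2 <= n)%N)
    (k : R) (hk0 : 0 < k) (hkn : k < n%:R)
    (a q b : R) (ha : 0 < a) (hq1 : 1 <= q) (hqn : q < n%:R / (n%:R - k))
    (habq : (n%:R + b) / q = n%:R - k + a)
    (haN : ~~ (a \is a Num.nat)) :
  exists C : R, 0 < C /\
    forall f : 'rV[R]_n -> E,
      Cc_infty e f ->
      vanishing_moments e (Num.floor a) f ->
      ((\int[lebesgue_rV n]_x
          (enorm x `^ b * vnorm e (riesz_potential e k f x) `^ q)%:E) `^ q^-1
       <= C%:E * \int[lebesgue_rV n]_x (enorm x `^ a * vnorm e (f x))%:E)%E.
Proof.
have s0 : 0 < n%:R - k by rewrite subr_gt0.
have q0 : 0 < q := lt_le_trans ltr01 hq1.
have sqn : (n%:R - k) * q < n%:R by rewrite mulrC -ltr_pdivlMr.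
have nb : n%:R + b = q * ((n%:R - k) + a).
  by rewrite -habq mulrC divfK// gt_eqF.
pose N := `|Num.floor a|%N.
have flN : Num.floor a = N%:Z by rewrite gez0_abs// floor_ge0 ltW.
have Na : N%:R < a.
  rewrite lt_neqAle; apply/andP; split.
    by apply: contraNneq haN => <-; exact: natr_nat.
  by have := floor_le a; rewrite flN.
have aN : a < N.+1%:R.
  by have := floorD1_gt a; rewrite flN intrD -natr1.
have [p [C [C0 kb]]] := exists_kernel_bounds R n N _ s0.
have [K [K0 HK]] := reduced_kernel_integral n N _ a b q p C s0 hq1 sqn nb Na aN C0 kb.
exists (m%:R * K `^ q^-1 + 1); split; first by rewrite ltr_wpDl// mulr_ge0 ?powR_ge0.
move=> f hf; rewrite flN => vm.
have v0 y : 0 <= vnorm e (f y) := enorm_ge0 _ _ _.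
pose w y := enorm y `^ a * vnorm e (f y).
have w0 y : 0 <= w y by rewrite mulr_ge0 ?powR_ge0.
pose mu := (\int[lebesgue_rV n]_y (w y)%:E)%E; rewrite -[X in (_ <= _ * X)%E]/mu.
have mu0 : (0 <= mu)%E by apply: integral_ge0 => x _; rewrite lee_fin.
have Cst0 : 0 < m%:R * K `^ q^-1 + 1 by rewrite ltr_wpDl// mulr_ge0 ?powR_ge0.
(* An infinite right-hand side is trivial since the constant is positive; this is
   the reason for adding 1 to it. *)
have [muoo|/eqP muoo] := eqVneq mu +oo%E.
  by rewrite muoo gt0_muley ?lte_fin// leey.
have [M muM] : exists M, mu = M%:E.
  by exists (fine mu); rewrite fineK// ge0_fin_numE// ltey; exact/eqP.
have M0 : 0 <= M by rewrite -lee_fin -muM.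
have mid : measurable_fun setT (@id 'rV[R]_n) by exact: measurable_id.
have mpow r : measurable_fun setT (fun y : 'rV[R]_n => enorm y `^ r).
  have mp := @measurable_powR R r; apply: (measurableT_comp mp).
  exact: measurable_fun_enorm.
have mw : measurable_fun setT w.
  by apply: measurable_funM; [exact: mpow|exact: measurable_vnorm].
pose RK := fun x y : 'rV[R]_n => `|reduced_kernel N (n%:R - k) p x y|.
have RK0 x y : 0 <= RK x y by exact: normr_ge0.
have mRK2 : measurable_fun setT (fun z : 'rV[R]_n * 'rV[R]_n => RK z.1 z.2).
  by apply: measurableT_comp => //; exact: measurable_reduced_kernel.
have mRK x : measurable_fun setT (RK x).
  exact: (measurableT_comp mRK2 (measurable_pair1 x)).
pose Psi (z : 'rV[R]_n * 'rV[R]_n) : \bar R :=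
  (enorm z.1 `^ b * (RK z.1 z.2 `^ q * (enorm z.2 `^ (- (a * q)) * w z.2)))%:E.
have Psi0 z : (0 <= Psi z)%E by rewrite lee_fin !mulr_ge0 ?powR_ge0.
have mPsi : measurable_fun setT Psi.
  apply/measurable_EFinP; apply: measurable_funM.
    have mb := mpow b; exact: (measurableT_comp mb measurable_fst).
  apply: measurable_funM.
    have mp := @measurable_powR R q; exact: (measurableT_comp mp mRK2).
  apply: measurable_funM.
    have ma := mpow (- (a * q)); exact: (measurableT_comp ma measurable_snd).
  exact: (measurableT_comp mw measurable_snd).
(* Hoelder's inequality in y for the measure |y|^a |f(y)| dy, whose mass is M; the
   compensating factor |y| ^ (-a) goes with the kernel. *)
have pointwise x : ((enorm x `^ b * vnorm e (riesz_potential e k f x) `^ q)%:E <=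
    (m%:R `^ q * M `^ (q - 1))%:E * \int[lebesgue_rV n]_y Psi (x, y))%E.
  pose H y := RK x y * enorm y `^ (- a).
  have mH : measurable_fun setT H by apply: measurable_funM.
  have H0 y : 0 <= H y by rewrite mulr_ge0 ?powR_ge0.
  have Hw y : RK x y * vnorm e (f y) = H y * w y.
    (* At y = 0 the weight |y| ^ a kills f, but so does the reduced kernel. *)
    have [->|y0] := eqVneq y 0.
      by rewrite /H /RK (reduced_kernel_x0 _ _ _ _ _ _ s0 kb) normr0 !mul0r.
    rewrite /H /w -[RHS]mulrA; congr (_ * _); rewrite mulrA powRN mulVf ?mul1r//.
    by rewrite powR_eq0 enorm_eq0 (negbTE y0).
  have vI : ((vnorm e (riesz_potential e k f x))%:E <=
      m%:R%:E * \int[lebesgue_rV n]_y (H y * w y)%:E)%E.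
    apply: le_trans (vnorm_riesz_le _ he _ hf N k p x hk0 vm) _.
    by under eq_integral do rewrite Hw.
  have Hw0 : (0 <= \int[lebesgue_rV n]_y (H y * w y)%:E)%E.
    by apply: integral_ge0 => y _; rewrite lee_fin mulr_ge0.
  have vq : ((vnorm e (riesz_potential e k f x) `^ q)%:E <=
      (m%:R `^ q * M `^ (q - 1))%:E * \int[lebesgue_rV n]_y (H y `^ q * w y)%:E)%E.
    rewrite -poweR_EFin.
    apply: le_trans (le_poweR _ _ _ _ (ltW q0) _ vI) _; first by rewrite lee_fin enorm_ge0.
    rewrite poweRM// poweR_EFin EFinM -muleA; apply: lee_wpmul2l.
      by rewrite lee_fin powR_ge0.
    apply: le_trans (weighted_hoelder _ _ _ _ _ _ _ hq1 mH mw H0 w0) _.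
    by rewrite -/mu muM poweR_EFin.
  rewrite EFinM; apply: le_trans (lee_wpmul2l _ vq) _; first by rewrite lee_fin powR_ge0.
  rewrite muleCA; apply: lee_wpmul2l; first by rewrite lee_fin mulr_ge0 ?powR_ge0.
  rewrite -ge0_integralZl_EFin//; last 3 first.
  - by move=> y _; rewrite lee_fin mulr_ge0 ?powR_ge0.
  - apply/measurable_EFinP; apply: measurable_funM => //.
    have mp := @measurable_powR R q; exact: (measurableT_comp mp mH).
  - exact: powR_ge0.
  rewrite le_eqVlt; apply/orP; left; apply/eqP; apply: eq_integral => y _.
  rewrite -EFinM /Psi/= /H powRM ?powR_ge0// -powRrM mulNr.
  by rewrite !mulrA.
(* Tonelli, then the estimate of the inner integral in x by |y| ^ (a q). *)
have intPsi : (\int[lebesgue_rV n]_x \int[lebesgue_rV n]_y Psi (x, y) <= (K * M)%:E)%E.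
  rewrite (fubini_tonelli Psi)// EFinM -muM.
  rewrite -ge0_integralZl_EFin//; last 2 first.
  - by move=> y _; rewrite lee_fin.
  - exact/measurable_EFinP.
  apply: ge0_le_integral_nomeas => y; first by apply: integral_ge0 => x _.
  rewrite (_ : \int[_]_x _ = (enorm y `^ (- (a * q)) * w y)%:E *
      \int[lebesgue_rV n]_x (enorm x `^ b * RK x y `^ q)%:E)%E; last first.
    rewrite -ge0_integralZl_EFin//.
    - by apply: eq_integral => x _; rewrite -EFinM /Psi/=; congr EFin; ring.
    - by move=> x _; rewrite lee_fin mulr_ge0 ?powR_ge0.
    - apply/measurable_EFinP; apply: measurable_funM => //.
      have mp := @measurable_powR R q; apply: (measurableT_comp mp).
      exact: (measurableT_comp mRK2 (measurable_pair2 y)).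
    - by rewrite mulr_ge0 ?powR_ge0.
  apply: le_trans (lee_wpmul2l _ (HK y)) _; first by rewrite lee_fin mulr_ge0 ?powR_ge0.
  rewrite -!EFinM lee_fin mulrCA ler_wpM2l// mulrAC ler_piMl//.
  rewrite powRN; have [->|y0] := eqVneq (enorm y `^ (a * q)) 0; first by rewrite mulr0.
  by rewrite mulVf.
have total : (\int[lebesgue_rV n]_x
    (enorm x `^ b * vnorm e (riesz_potential e k f x) `^ q)%:E <=
    (m%:R `^ q * K * M `^ q)%:E)%E.
  apply: (@le_trans _ _ (\int[lebesgue_rV n]_x ((m%:R `^ q * M `^ (q - 1))%:E *
      \int[lebesgue_rV n]_y Psi (x, y)))%E).
    apply: ge0_le_integral_nomeas => x //.
    by rewrite lee_fin mulr_ge0 ?powR_ge0.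
  rewrite ge0_integralZl_EFin//; last 3 first.
  - by move=> x _; apply: integral_ge0.
  - exact: (measurable_fun_fubini_tonelli_F Psi).
  - by rewrite mulr_ge0 ?powR_ge0.
  apply: le_trans (lee_wpmul2l _ intPsi) _; first by rewrite lee_fin mulr_ge0 ?powR_ge0.
  rewrite -EFinM lee_fin -(mulr_powRB1 M0 q0).
  by rewrite le_eqVlt; apply/orP; left; apply/eqP; ring.
have I0 : (0 <= \int[lebesgue_rV n]_x
    (enorm x `^ b * vnorm e (riesz_potential e k f x) `^ q)%:E)%E.
  by apply: integral_ge0 => x _; rewrite lee_fin mulr_ge0 ?powR_ge0.
have qV0 : 0 <= q^-1 by rewrite invr_ge0 ltW.
apply: le_trans (le_poweR _ _ _ _ qV0 I0 total) _.
rewrite muM poweR_EFin -EFinM lee_fin.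
rewrite powRM ?mulr_ge0 ?powR_ge0// powRM ?powR_ge0// -!powRrM mulfV ?gt_eqF//.
by rewrite !powRr1// mulrDl mul1r lerDl.
Qed.
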